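(* Suppose conditions (M1)-(M3) of the context hold. Then for any $p\ge2$, there exists $K=K(p)>0$ such that $$\max_{j\in[n]}\mathbb{E}|\hat w_{A,j}^{\mathsf M}|^p\le K\big\{(L_0/\lambda)^pM_{p;A}+\lVert\mu_0\rVert_\infty^p\big\}.$$ Here $M_{p;A}\equiv\max_{i\in[m],j\in[n]}\mathbb{E}|A_{0;ij}|^p$.
   Context: Linear model $Y=A\mu_0+\xi$ with $\mu_0\in\mathbb{R}^n$, $A\in\mathbb{R}^{m\times n}$, $\xi\in\mathbb{R}^m$. Robust regression error: $$\hat w_A^{\mathsf M}\equiv\arg\min_{w\in\mathbb{R}^n}\Big\{\sum_{i=1}^m\psi_0\big((Aw)_i-\xi_i\big)+\frac\lambda2\lVert w+\mu_0\rVert^2\Big\}.$$ Conditions: (M1) $\tau\le m/n\le1/\tau$ for some $\tau\in(0,1)$, and $\lambda>0$. (M2) $\psi_0:\mathbb{R}\to\mathbb{R}$ is convex with weak derivative $\psi_0'$ satisfying $\max\{|\psi_0(0)|,\operatorname{ess\,sup}|\psi_0'|\}\le L_0$ for some $L_0>0$. (M3) $A_0=\sqrt mA$ and $\xi_0=\xi$ are independent. The entries of $A_0$ are independent, mean $0$, variance $1$, with $\max_{i\in[m],j\in[n]}\mathbb{E}|A_{0;ij}|^{6+\delta}<\infty$ for some $\delta\in(0,1)$. The entries of $\xi_0$ are independent. *)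

(* Defs.v *)
From HB Require Import structures.
From mathcomp Require Export all_boot all_order all_algebra.
From mathcomp Require Export all_classical all_reals all_analysis ess_sup_inf.
Export numFieldNormedType.Exports.

Set Implicit Arguments.
Unset Strict Implicit.
Unset Printing Implicit Defensive.

Import Order.TTheory GRing.Theory Num.Theory.

Local Open Scope classical_set_scope.
Local Open Scope ring_scope.

Section weak_derivative.
Context {R : realType}.
Implicit Types f g phi : R -> R.

(* phi belongs to C_c^oo(R) *)
Definition test_function phi : Prop :=
  (forall k x, derivable (derive1n k phi) x 1) /\
  compact (closure [set x | phi x != 0]).

Definition is_weak_derivative f g : Prop :=
  [/\ locally_integrable setT f, locally_integrable setT g &
      forall phi, test_function phi ->
        (\int[lebesgue_measure]_x (f x * derive1 phi x)%:E =
         - \int[lebesgue_measure]_x (g x * phi x)%:E)%E].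

End weak_derivative.

Section independence.
Context {d : measure_display} {T : measurableType d} {R : realType}.
Variable P : probability T R.

Definition mutually_independent (I : finType) (X : I -> T -> R) : Prop :=
  forall (J : {set I}) (B : I -> set R), (forall i, measurable (B i)) ->
    P (\bigcap_(i in [set` J]) (X i @^-1` B i)) =
    (\prod_(i in J) P (X i @^-1` B i))%E.

Definition sigma_of (I : Type) (X : I -> T -> R) : set (set T) :=
  <<s \bigcup_i preimage_set_system setT (X i) measurable >>.

Definition independent_families (I J : Type)
    (X : I -> T -> R) (Y : J -> T -> R) : Prop :=
  forall E F, sigma_of X E -> sigma_of Y F -> P (E `&` F) = (P E * P F)%E.

End independence.

Section robust_regression.
Context {R : realType}.

Section estimator.
Context {m n : nat}.
Variables (psi : R -> R) (lambda : R) (mu0 : 'cV[R]_n).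
Variables (A : 'M[R]_(m, n)) (xi : 'cV[R]_m).

Definition robust_loss (w : 'cV[R]_n) : R :=
  \sum_(i < m) psi ((A *m w) i 0 - xi i 0)
  + lambda / 2 * \sum_(j < n) ((w + mu0) j 0) ^+ 2.

(* For psi convex and lambda > 0 the loss has exactly one minimizer;
   the default value 0 is irrelevant in that case. *)
Definition robust_error : 'cV[R]_n :=
  xget 0 [set w | forall v, robust_loss w <= robust_loss v].

End estimator.

(* When n = 0 (resp. m = 0) the quotient is 0 and the condition fails,
   so condM1 implies 0 < m and 0 < n. *)
Definition condM1 (m n : nat) (lambda : R) : Prop :=
  (exists tau : R, 0 < tau < 1 /\ tau <= m%:R / n%:R <= tau^-1) /\
  0 < lambda.

Definition condM2 (psi : R -> R) (L0 : R) : Prop :=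
  [/\ convex_function (setT : set R) psi,
      0 < L0 &
      exists dpsi : R -> R, is_weak_derivative psi dpsi /\
        (maxe `|psi 0|%:E
              (ess_sup lebesgue_measure (fun x => `|dpsi x|%:E)) <= L0%:E)%E].

Section random_design.
Context {d : measure_display} {T : measurableType d}.
Variable P : probability T R.
Context {m n : nat}.

Definition scaled_entry (A : T -> 'M[R]_(m, n)) (ij : 'I_m * 'I_n) : T -> R :=
  fun t => Num.sqrt m%:R * A t ij.1 ij.2.

Definition entry_moment (p : R) (A : T -> 'M[R]_(m, n)) : \bar R :=
  \big[maxe/-oo%E]_(i < m) \big[maxe/-oo%E]_(j < n)
    'E_P[fun t => (`|scaled_entry A (i, j) t| `^ p)%R]%E.

Definition condM3 (A : T -> 'M[R]_(m, n)) (xi : T -> 'cV[R]_m) : Prop :=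
  let A0 := scaled_entry A in
  let xi0 := fun (i : 'I_m) (t : T) => xi t i 0 in
  [/\ (forall ij, measurable_fun setT (A0 ij)) /\
      (forall i, measurable_fun setT (xi0 i)),
      independent_families P A0 xi0,
      mutually_independent P A0,
      (forall ij, 'E_P[A0 ij] = 0 /\ 'V_P[A0 ij] = 1)%E /\
      (exists delta : R, 0 < delta < 1 /\
        (entry_moment (6 + delta) A < +oo)%E) &
      mutually_independent P xi0].

End random_design.

End robust_regression.

(* Main.v *)
(* Fix a column j and write a_i = A_ij. Relax the loss in every other column,
   adding slack variables r with a quadratic penalty |r|^2 / (2 eps). At a
   near-minimiser (w, r) the vector c = r / eps stays bounded by 3 L_0 and plays
   the role of psi_0' at the leave-one-out residuals, so psi_0 is never
   differentiated. Comparing the robust error v with w, through two convexity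
   competitors, gives
     |v_j| <= 4 |mu_j| + (4 / lambda) |sum_i c_i a_i|
              + (4 L_0 / lambda) (sum_i |a_i|) / m + theta
   with theta > 0 as small as desired. As the relaxed loss does not involve
   column j, c can be chosen as a measurable function of the other columns and
   of xi, hence independent of (a_i). The moment of order p of sum_i c_i a_i is
   then bounded by adding one entry at a time: by Tonelli it suffices to
   integrate in y the pointwise inequality
     |x + y|^p <= (1 + D/m) |x|^p + l y + D m^(p/2 - 1) |y|^p,
   whose linear term vanishes since E y = 0, and (1 + D/m)^m <= exp D. *)
From HB Require Import structures.
From mathcomp Require Import ring lra measurable_realfun.
Require Import Defs.

Set Implicit Arguments.
Unset Strict Implicit.
Unset Printing Implicit Defensive.

Import Order.TTheory GRing.Theory Num.Theory.
Local Open Scope classical_set_scope.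
Local Open Scope ring_scope.

(** * A pointwise moment inequality *)

(** Minimising the relaxed loss over [r] replaces [psi_0] by its Moreau envelope of parameter [eps];
    at an exact minimiser [r / eps] would be the derivative of that envelope. A near-minimiser
    suffices, and one can be picked in a countable dense set, which turns measurability of the
    choice into countable operations. The bound on [c] does not involve [eps], so [eps] may be taken
    as small as [theta] requires, with [m] fixed, while the constants keep depending on [p] alone.
    The term [(sum_i |a_i|) / m] is the price of near-optimality: the competitor moves by a step [t]
    of order [eps / sum_i a_i^2], and the optimality gap gets divided by [t]. The weak derivative is
    controlled almost everywhere only. It is turned into a Lipschitz bound by testing it on a bump
    next to a chord, where convexity compares the increments of [psi_0] with the slope of that
    chord. The power of [m] balances exactly: [m] entries, each carrying a weight [m^(-1/2)] in
    front of [A_0], contribute [m * m^(p/2 - 1) * m^(-p/2) = 1]. *)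

Section scalar_inequality.
Context {R : realType}.
Implicit Types p N u x y : R.

Lemma powR_homo p x y : 0 <= p -> 0 <= x -> x <= y -> x `^ p <= y `^ p.
Proof.
by move=> p0 x0 xy; apply: ge0_ler_powR; rewrite // nnegrE (le_trans x0).
Qed.

(** [2 p^2] serves small arguments, where a second-order expansion holds, and [(1 + 2 p)^p] large
    ones, see [powR_1D_le]. *)
Definition growth_cst p : R := 2 * p ^+ 2 + (1 + 2 * p) `^ p.

Lemma growth_cst_ge0 p : 0 <= growth_cst p.
Proof. by rewrite /growth_cst addr_ge0// ?powR_ge0// mulr_ge0// sqr_ge0. Qed.

(** [exp x <= 1 / (1 - x)], and [(1 - x) (1 + x + 2 x^2) = 1 + x^2 (1 - 2 x)] is at least 1 in this
    range. *)
Lemma expR_le1Dx2 x : x <= 2^-1 -> expR x <= 1 + x + 2 * x ^+ 2.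
Proof.
move=> x2; have x1 : 0 < 1 - x by lra.
have := expR_ge1Dx (- x) => h.
have e0 := expR_gt0 x.
have : expR x * (1 - x) <= 1.
  by rewrite -[leRHS](expRxMexpNx_1 x) ler_pM2l.
nra.
Qed.

(** If [|u| <= 1 / (2 p)], then [(1 + u)^p <= exp (p u)], which is expanded to second order.
    Otherwise [1 < 2 p |u|], so that [|1 + u| <= (1 + 2 p) |u|], while the quadratic
    [1 + p u + 2 p^2 u^2] has negative discriminant and only helps. *)
Lemma powR_1D_le p u : 2 <= p ->
  `|1 + u| `^ p <= 1 + p * u + 2 * p ^+ 2 * u ^+ 2 + (1 + 2 * p) `^ p * `|u| `^ p.
Proof.
move=> p2; have p0 : 0 < p by lra.
have [up|up] := lerP `|u| ((2 * p)^-1).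
- have pu : p * `|u| <= 2^-1.
    rewrite -(@ler_pM2l _ p)// in up; apply: le_trans up _.
    by rewrite invfM mulrCA divff ?mulr1// gt_eqF.
  have u1 : `|u| <= 2^-1.
    apply: le_trans pu; rewrite -[leLHS]mul1r ler_wpM2r//; lra.
  have u0 : 0 < 1 + u by move: u1; rewrite ler_norml; lra.
  apply: (@le_trans _ _ (expR (p * u))).
    rewrite gtr0_norm// mulrC expRM; apply: powR_homo; [exact: ltW|exact: ltW|].
    exact: expR_ge1Dx.
  apply: (@le_trans _ _ (1 + p * u + 2 * (p * u) ^+ 2)).
    apply: expR_le1Dx2; apply: le_trans pu; rewrite ler_pM2l//; exact: ler_norm.
  by rewrite exprMn mulrA lerDl mulr_ge0// powR_ge0.
- have u1 : 1 <= 2 * p * `|u|.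
    by rewrite -ler_pdivrMl ?mulr1 1?ltW// mulr_gt0.
  apply: (@le_trans _ _ ((1 + 2 * p) `^ p * `|u| `^ p)).
    rewrite -powRM//; last by lra.
    apply: powR_homo => //; first lra.
    rewrite mulrDl mul1r (le_trans (ler_normD _ _))// normr1 addrC lerD2l//.
  rewrite lerDr; nra.
Qed.

(** The square is traded for [1 / N + N^(p/2 - 1) |u|^p]: once [u^2 > 1 / N], the factor
    [(N u^2)^(p/2 - 1)] is at least 1. A relative cost of order [1 / N] can then be paid [N]
    times. *)
Lemma powR_1D_le_scale p N u : 2 <= p -> 1 <= N ->
  `|1 + u| `^ p <= 1 + growth_cst p / N + p * u
                   + growth_cst p * N `^ (p / 2 - 1) * `|u| `^ p.
Proof.
move=> p2 N1; have N0 : 0 < N by lra.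
have q0 : 0 <= p / 2 - 1 by lra.
apply: le_trans (powR_1D_le u p2) _.
set Q := N `^ _; set V := `|u| `^ p; set D := (1 + 2 * p) `^ p.
have Q1 : 1 <= Q by rewrite -[leLHS](@powRr0 _ N) /Q; apply: ler_powR.
have D0 : 0 <= D by exact: powR_ge0.
have V0 : 0 <= V by exact: powR_ge0.
have uu : u ^+ 2 <= N^-1 + Q * V.
  have [uN|uN] := lerP (u ^+ 2) N^-1.
    by rewrite (le_trans uN)// lerDl mulr_ge0// (le_trans _ Q1).
  have Nu : 1 <= N * `|u| ^+ 2.
    by rewrite real_normK ?num_real// -ler_pdivrMl ?mulr1 1?ltW.
  have u0 : 0 < `|u|.
    by rewrite normr_gt0; apply: contraTneq Nu => ->; rewrite normr0 expr0n mulr0 -ltNge.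
  have -> : Q * V = u ^+ 2 * (N * `|u| ^+ 2) `^ (p / 2 - 1).
    rewrite powRM ?sqr_ge0 ?ltW// mulrCA; congr (_ * _).
    rewrite /V -(real_normK (num_real u)) -[_ ^+ 2 in RHS]powR_mulrn// -powRrM.
        rewrite -powRD; last by rewrite (gt_eqF u0) implybT.
    by congr (_ `^ _); lra.
  rewrite -[leLHS]mulr1 -[leLHS]add0r.
  apply: lerD; first by rewrite invr_ge0 ltW.
  apply: ler_wpM2l; first exact: sqr_ge0.
  have e1 : 1 `^ (p / 2 - 1) = 1 :> R by rewrite powR1.
  by rewrite -[leLHS]e1; exact: powR_homo.
rewrite /growth_cst -/D.
have Ni0 : 0 <= N^-1 by rewrite invr_ge0 ltW.
have pp : 0 <= 2 * p ^+ 2 by rewrite mulr_ge0 ?sqr_ge0.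
have h1 := ler_wpM2l pp uu.
have h2 : D * V <= D * (Q * V) by rewrite ler_wpM2l// ler_peMl.
have h3 : 0 <= D * N^-1 by rewrite mulr_ge0.
lra.
Qed.

(* [l] is the derivative of [y |-> |x + y|^p] at [0]. *)
Lemma powR_add_le p N x : 2 <= p -> 1 <= N ->
  exists l : R, forall y, `|x + y| `^ p <=
    (1 + growth_cst p / N) * `|x| `^ p + l * y
    + growth_cst p * N `^ (p / 2 - 1) * `|y| `^ p.
Proof.
move=> p2 N1; have p0 : p != 0 by lra.
have [->|x0] := eqVneq x 0.
  exists 0 => y; rewrite add0r normr0 powR0// mulr0 mul0r !add0r.
  rewrite ler_peMl ?powR_ge0// mulr_ege1//.
    rewrite /growth_cst -[leLHS]add0r; apply: lerD; first by rewrite mulr_ge0// sqr_ge0.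
    by rewrite -[leLHS](@powRr0 _ (1 + 2 * p)); apply: ler_powR; lra.
  by rewrite -[leLHS](@powRr0 _ N); apply: ler_powR => //; lra.
exists (`|x| `^ p * p / x) => y.
have -> : x + y = x * (1 + y / x) by rewrite mulrDr mulr1 mulrCA divff// mulr1.
rewrite normrM powRM//.
apply: le_trans (ler_wpM2l (powR_ge0 _ _) (powR_1D_le_scale (y / x) p2 N1)) _.
have -> : `|y| `^ p = `|x| `^ p * `|y / x| `^ p.
  by rewrite -powRM// -normrM mulrCA divff// mulr1.
rewrite le_eqVlt; apply/orP; left; apply/eqP; ring.
Qed.

End scalar_inequality.

(** * Moments of sums with independent centred increments *)

Section independent_tonelli.
Local Open Scope ereal_scope.
Context {d d1 d2} {T : measurableType d} {T1 : measurableType d1}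
  {T2 : measurableType d2} {R : realType}.
Variable P : probability T R.
Variables (U : {mfun T >-> T1}) (V : {mfun T >-> T2}).
Hypothesis UV : forall A B, measurable A -> measurable B ->
  P (U @^-1` A `&` V @^-1` B) = P (U @^-1` A) * P (V @^-1` B).

Let W t := (U t, V t).

Let mW : measurable_fun setT W.
Proof. by apply: measurable_fun_pair. Qed.

Let mW_mixin := isMeasurableFun.Build _ _ _ _ _ mW.
Let W_pack : {mfun T >-> (T1 * T2)%type} := HB.pack W mW_mixin.

(** Independence on rectangles identifies the law of [(U, V)] with the product of the two laws, by
    uniqueness of the product measure; Tonelli on that product is then pulled back to the
    probability space. *)
Lemma independent_tonelli (f : T1 * T2 -> \bar R) :
  measurable_fun setT f -> (forall z, 0 <= f z) ->
  \int[P]_t f (U t, V t) = \int[P]_t \int[P]_s f (U t, V s).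
Proof.
move=> mf f0.
have := @ge0_integral_distribution _ _ _ _ _ P W_pack f mf f0 => /= <-.
rewrite (eq_measure_integral (distribution P U \x distribution P V)); last first.
  move=> A mA _; apply/esym; exact: product_measure_unique.
rewrite fubini_tonelli1//.
have mF := @measurable_fun_fubini_tonelli_F _ _ _ _ _ (distribution P V) _ mf f0.
rewrite ge0_integral_distribution//; last first.
  by move=> y; apply: integral_ge0.
apply: eq_integral => t _ /=; rewrite /fubini_F.
rewrite ge0_integral_distribution//.
exact: measurableT_comp.
Qed.

End independent_tonelli.

Lemma measurable_powR_norm {d} {T : measurableType d} {R : realType} (p : R)
    (f : T -> R) :
  measurable_fun setT f -> measurable_fun setT (fun t => `|f t| `^ p).
Proof.
move=> mf; apply: (measurableT_comp (@measurable_powR R p)).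
exact: measurableT_comp.
Qed.

Section moment_step.
Context {d d1} {T : measurableType d} {T1 : measurableType d1} {R : realType}.
Variable P : probability T R.
Variables (U : {mfun T >-> T1}) (V : {mfun T >-> R}).
Hypothesis UV : forall A B, measurable A -> measurable B ->
  (P (U @^-1` A `&` V @^-1` B) = P (U @^-1` A) * P (V @^-1` B))%E.
Variables (p b : R).
Hypothesis p2 : 2 <= p.
Let p1 : 1 <= p. Proof. have := p2; lra. Qed.
Let p0 : 0 <= p. Proof. have := p2; lra. Qed.
Hypothesis EV0 : ('E_P[V] = 0)%E.
Hypothesis EVp : ('E_P[fun t => (`|V t| `^ p)%R] <= b%:E)%E.

Let mVp : measurable_fun setT (fun t => `|V t| `^ p).
Proof. exact: measurable_powR_norm. Qed.

Let iVp : P.-integrable setT (fun t => (`|V t| `^ p)%:E).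
Proof.
apply/integrableP; split; first exact/measurable_EFinP.
under eq_integral do rewrite gee0_abs ?lee_fin ?powR_ge0//.
by move: EVp; rewrite unlock => /le_lt_trans; apply; rewrite ltry.
Qed.

Lemma integrable_of_moment : P.-integrable setT (EFin \o V).
Proof.
have i1 : P.-integrable setT (cst 1%:E).
  exact: finite_measure_integrable_cst.
apply: (le_integrable measurableT _ _ (integrableD measurableT i1 iVp)).
  exact/measurable_EFinP.
move=> t _ /=; rewrite lee_fin ?addrfctE.
rewrite [leRHS]ger0_norm; last by rewrite addr_ge0 ?powR_ge0.
have [V1|V1] := lerP `|V t| 1; first by rewrite (le_trans V1)// lerDl powR_ge0.
rewrite -[leLHS]add0r lerD//; apply: le1r_powR; [exact: ltW|exact: p1].
Qed.

(** The slope [l] is obtained separately for each frozen [x] and disappears on integrating against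
    the centred [V], so its dependence on [x] never has to be measurable. *)
Lemma affine_moment_le (N x a : R) : 1 <= N ->
  (\int[P]_t (`|x + a * V t| `^ p)%:E <=
   ((1 + growth_cst p / N) * `|x| `^ p
    + growth_cst p * N `^ (p / 2 - 1) * `|a| `^ p * b)%:E)%E.
Proof.
move=> N1.
have [l hl] := powR_add_le x p2 N1.
set c1 := _ * `|x| `^ p; set c2 := growth_cst p * _ * _.
have c20 : 0 <= c2.
  by rewrite /c2 mulr_ge0 ?powR_ge0// mulr_ge0 ?powR_ge0 ?growth_cst_ge0.
have iV := integrable_of_moment.
apply: (@le_trans _ _ (\int[P]_t (c1%:E + ((l * a)%:E * (V t)%:E
    + c2%:E * (`|V t| `^ p)%:E)))%E).
  apply: ge0_le_integral => //.
  - apply/measurable_EFinP/measurable_powR_norm/measurable_funD => //.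
    exact: measurable_funM.
  - apply: emeasurable_funD => //; apply: emeasurable_funD.
      by apply: measurable_funeM; exact/measurable_EFinP.
    by apply: measurable_funeM; exact/measurable_EFinP.
  - move=> t _; rewrite -!EFinM -!EFinD lee_fin.
    apply: le_trans (hl (a * V t)) _.
    rewrite normrM powRM// /c1 /c2 le_eqVlt; apply/orP; left; apply/eqP; ring.
rewrite integralD//=; last 2 first.
- exact: finite_measure_integrable_cst.
- by apply: integrableD => //; exact: integrableZl.
rewrite integralD//=; [|exact: integrableZl|exact: integrableZl].
rewrite integral_cst//= probability_setT mule1 integralZl//.
move: EV0; rewrite unlock => ->; rewrite mule0 add0e integralZl//.
rewrite EFinD leeD2lE// [leRHS]EFinM lee_wpmul2l ?lee_fin//.
by move: EVp; rewrite unlock.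
Qed.

Lemma moment_step (N B : R) (X a : T1 -> R) : 1 <= N ->
  measurable_fun setT X -> measurable_fun setT a ->
  (forall u, `|a u| <= B) ->
  ('E_P[fun t => (`|X (U t) + a (U t) * V t| `^ p)%R] <=
   (1 + growth_cst p / N)%:E * 'E_P[fun t => (`|X (U t)| `^ p)%R]
   + (growth_cst p * N `^ (p / 2 - 1) * B `^ p * b)%:E)%E.
Proof.
move=> N1 mX ma aB; rewrite unlock.
have b0 : 0 <= b.
  rewrite -lee_fin; apply: le_trans EVp; rewrite unlock.
  by apply: integral_ge0 => t _; rewrite lee_fin powR_ge0.
set c1 := 1 + _; set c2 := growth_cst p * _.
have c10 : 0 <= c1.
  by by rewrite addr_ge0// divr_ge0 ?growth_cst_ge0// (le_trans _ N1).
have c20 : 0 <= c2 by rewrite mulr_ge0 ?powR_ge0 ?growth_cst_ge0.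
have mf : measurable_fun setT
    (fun z : T1 * R => (`|X z.1 + a z.1 * z.2| `^ p)%:E).
  apply/measurable_EFinP/measurable_powR_norm/measurable_funD.
    exact: measurableT_comp.
  by apply: measurable_funM => //; exact: measurableT_comp.
have f0 (z : T1 * R) : (0 <= (`|X z.1 + a z.1 * z.2| `^ p)%:E)%E.
  by rewrite lee_fin powR_ge0.
have /= -> := independent_tonelli UV mf f0.
have mXU : measurable_fun setT (fun t => (`|X (U t)| `^ p)%:E).
  by apply/measurable_EFinP/measurable_powR_norm; exact: measurableT_comp.
apply: (@le_trans _ _ (\int[P]_t (c1%:E * (`|X (U t)| `^ p)%:E
    + (c2 * B `^ p * b)%:E))%E).
  apply: ge0_le_integral => //.
  - by move=> t _; apply: integral_ge0.
  - have := @measurable_fun_fubini_tonelli_F _ _ _ _ _ (distribution P V) _ mf f0.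
    rewrite /fubini_F => mF.
    have -> : (fun t => \int[P]_s (`|X (U t) + a (U t) * V s| `^ p)%:E)%E =
        (fun u => \int[distribution P V]_y (`|X u + a u * y| `^ p)%:E)%E \o U.
      apply/funext => t /=; rewrite ge0_integral_distribution//.
        exact: (measurableT_comp mf (pair1_measurable (U t))).
    exact: measurableT_comp.
  - by apply: emeasurable_funD => //; exact: measurable_funeM.
  - move=> t _; apply: le_trans (affine_moment_le _ _ N1) _.
    rewrite -EFinM -EFinD lee_fin lerD2l ler_wpM2r// ler_wpM2l//.
    exact: powR_homo.
have k0 : 0 <= c2 * B `^ p * b.
  by apply: mulr_ge0 => //; apply: mulr_ge0 => //; exact: powR_ge0.
rewrite ge0_integralD//=; last 2 first.
- by move=> t _; rewrite -EFinM lee_fin mulr_ge0 ?powR_ge0.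
- exact: measurable_funeM.
rewrite ge0_integralZl//=.
by rewrite integral_cst//= probability_setT mule1.
Qed.

End moment_step.

(** The factor [expR (growth_cst p)] bounds [(1 + growth_cst p / m)^m], the product of the relative
    costs of all [m] steps. *)
Definition moment_cst {R : realType} (p : R) : R :=
  growth_cst p * expR (growth_cst p).

Section column_moment.
Context {d} {T : measurableType d} {R : realType}.
Variable P : probability T R.
Context {m : nat}.
Variables (G : 'I_m -> set (set T)) (V a : 'I_m -> T -> R) (p b B : R).
Hypothesis mG : forall i, G i `<=` measurable.
Hypothesis VG : forall i E C, <<s G i >> E -> measurable C ->
  (P (E `&` V i @^-1` C) = P E * P (V i @^-1` C))%E.
Hypothesis mV : forall i, measurable_fun setT (V i).
Hypothesis mVG : forall i k, k != i ->
  measurable_fun setT (V k : g_sigma_algebraType (G i) -> R).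
Hypothesis maG : forall i k,
  measurable_fun setT (a k : g_sigma_algebraType (G i) -> R).
Hypothesis aB : forall k t, `|a k t| <= B.
Hypothesis p2 : 2 <= p.
Hypothesis EV0 : forall i, ('E_P[V i] = 0)%E.
Hypothesis EVp : forall i, ('E_P[fun t => (`|V i t| `^ p)%R] <= b%:E)%E.

Let S k t := \sum_(i < m | (i < k)%N) a i t * V i t.

Lemma column_moment_rec (k : 'I_m) :
  ('E_P[fun t => (`|S k.+1 t| `^ p)%R] <=
   (1 + growth_cst p / m%:R)%:E * 'E_P[fun t => (`|S k t| `^ p)%R]
   + (growth_cst p * m%:R `^ (p / 2 - 1) * B `^ p * b)%:E)%E.
Proof.
have m1 : 1 <= m%:R :> R by rewrite ler1n (leq_trans _ (ltn_ord k)).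
(* [U] below is the identity of [T], with the target carrying the smaller sigma-algebra generated by
   [G k]. Functions measurable for that sigma-algebra thereby become functions of [U], which is
   independent of [V k]. *)
pose T1 : measurableType _ := g_sigma_algebraType (G k).
have mid : measurable_fun setT (id : T -> T1).
  move=> _ A mA; rewrite setTI preimage_id.
  exact: (smallest_sub (@sigma_algebra_measurable _ T) (mG (i := k))).
pose mid_mixin := isMeasurableFun.Build _ _ _ _ _ mid.
pose U : {mfun T >-> T1} := HB.pack (id : T -> T1) mid_mixin.
pose mV_mixin := isMeasurableFun.Build _ _ _ _ _ (mV k).
pose W : {mfun T >-> R} := HB.pack (V k) mV_mixin.
have UW A C : measurable A -> measurable C ->
    (P (U @^-1` A `&` W @^-1` C) = P (U @^-1` A) * P (W @^-1` C))%E.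
  by move=> mA mC; exact: VG.
have mS : measurable_fun setT (S k : T1 -> R).
  rewrite /S; under eq_fun do rewrite big_mkcond/=.
  apply: measurable_sum => i /=; case: (boolP (i < k)%N) => ik; last exact: measurable_cst.
  apply: measurable_funM; first exact: maG.
  by apply: mVG; rewrite -val_eqE /= neq_ltn ik.
have := @moment_step _ _ _ _ _ P U W UW p b p2 (EV0 k) (EVp k) m%:R B
  (S k) (a k) m1 mS (@maG k k) (aB k).
rewrite /=; congr (_ <= _)%E; congr expectation; apply/funext => t.
congr (`|_| `^ _); rewrite /S [RHS](bigD1 k)//= [RHS]addrC; congr (_ + _).
by apply: eq_bigl => i; rewrite ltnS (leq_eqVlt i) -val_eqE; case: ltngtP.
Qed.

Lemma column_moment :
  ('E_P[fun t => (`|\sum_i a i t * V i t| `^ p)%R] <=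
   (moment_cst p * m%:R `^ (p / 2) * B `^ p * b)%:E)%E.
Proof.
have p0 : p != 0 by rewrite gt_eqF// (lt_le_trans _ p2).
have g0 := @growth_cst_ge0 R p.
have [m0|m0] := posnP m.
  rewrite (_ : (fun _ => _) = cst 0); last first.
    apply/funext => t; rewrite big1 ?normr0 ?powR0// => i.
    by have := leq_ltn_trans (leq0n i) (ltn_ord i); rewrite m0.
  rewrite expectation_cst lee_fin m0 powR0; last by rewrite mulf_neq0 ?invr_eq0.
  by rewrite mulr0 !mul0r.
have b0 : 0 <= b.
  rewrite -lee_fin; apply: le_trans (EVp (Ordinal m0)); rewrite unlock.
  by apply: integral_ge0 => t _; rewrite lee_fin powR_ge0.
set al := 1 + growth_cst p / m%:R.
set be := growth_cst p * m%:R `^ (p / 2 - 1) * B `^ p * b.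
have al1 : 1 <= al by rewrite lerDl divr_ge0.
have be0 : 0 <= be.
  by do 3?[apply: mulr_ge0 => //]; exact: powR_ge0.
(* A geometric sum of [k] terms is bounded by [k * al ^+ k], as [1 <= al]. At [k = m] the factor [m]
   completes [m^(p/2 - 1)] into [m^(p/2)]. *)
have rec k : (k <= m)%N ->
    ('E_P[fun t => (`|S k t| `^ p)%R] <= (k%:R * al ^+ k * be)%:E)%E.
  elim: k => [|k IH] km.
    rewrite (_ : (fun _ => _) = cst 0); last first.
      by apply/funext => t; rewrite /S big1 ?normr0 ?powR0.
    by rewrite expectation_cst !mul0r.
  apply: le_trans (column_moment_rec (Ordinal km)) _ => /=.
  rewrite -/al -/be.
  apply: (@le_trans _ _ (al%:E * (k%:R * al ^+ k * be)%:E + be%:E)%E).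
    rewrite leeD2r// lee_wpmul2l ?IH ?(ltnW km)// lee_fin.
    exact: le_trans al1.
  rewrite -EFinM -EFinD lee_fin -natr1 exprS.
  have : 1 <= al * al ^+ k by rewrite -exprS exprn_ege1.
  move=> /(ler_wpM2r be0); lra.
rewrite (_ : (fun _ => _) = fun t => `|S m t| `^ p); last first.
  apply/funext => t; congr (`|_| `^ _); rewrite /S.
  by apply: eq_bigl => i; rewrite ltn_ord.
apply: le_trans (rec _ (leqnn m)) _; rewrite lee_fin.
have alm : al ^+ m <= expR (growth_cst p).
  rewrite (_ : growth_cst p = m%:R * (growth_cst p / m%:R)); last first.
    by rewrite mulrCA divff ?mulr1// pnatr_eq0 -lt0n.
  by rewrite expRM_natl lerXn2r ?nnegrE ?expR_ge0 ?(le_trans _ al1)// expR_ge1Dx.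
have mp : m%:R * m%:R `^ (p / 2 - 1) = m%:R `^ (p / 2) :> R.
  by rewrite mulr_powRB1// divr_gt0// (lt_le_trans _ p2).
rewrite /moment_cst -mp /be.
set E := expR _; set g := growth_cst p; set Q := _ `^ (_ - 1).
have h : 0 <= m%:R * (g * Q * B `^ p * b).
  by apply: mulr_ge0.
have := ler_wpM2l h alm; rewrite -/E; lra.
Qed.

End column_moment.

(** * Independence of one entry from all the others *)

Section leave_one_out_independence.
Context {d} {T : measurableType d} {R : realType}.
Variable P : probability T R.
Context {I J : finType}.
Variables (X : I -> T -> R) (Y : J -> T -> R).
Hypothesis mX : forall i, measurable_fun setT (X i).
Hypothesis mY : forall j, measurable_fun setT (Y j).
Hypothesis XY : independent_families P X Y.
Hypothesis indX : mutually_independent P X.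

(* A pi-system generating the sigma-algebra of [Y] and of all the [X k] but [X q]. *)
Definition leave_one_out (q : I) : set (set T) :=
  [set C | exists B : I -> set R, exists F : set T,
     [/\ forall k, measurable (B k), sigma_of Y F &
       C = \bigcap_(k in [set` ~: [set q]%SET]) (X k @^-1` B k) `&` F]].

Lemma sigma_of_measurable (K : Type) (Z : K -> T -> R) :
  (forall k, measurable_fun setT (Z k)) -> sigma_of Z `<=` measurable.
Proof.
move=> mZ; apply: smallest_sub; first exact: sigma_algebra_measurable.
by move=> _ [k _ [B mB <-]]; exact: mZ.
Qed.

Lemma sigma_of_preimage (K : Type) (Z : K -> T -> R) k B :
  measurable B -> sigma_of Z (Z k @^-1` B).
Proof.
move=> mB; apply: sub_sigma_algebra; exists k => //.
by exists B => //; rewrite setTI.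
Qed.

Lemma sigma_of_setT (K : Type) (Z : K -> T -> R) : sigma_of Z setT.
Proof.
exact: (@measurableT _ (g_sigma_algebraType
  (\bigcup_i preimage_set_system setT (Z i) measurable))).
Qed.

Lemma sigma_of_setI (K : Type) (Z : K -> T -> R) : setI_closed (sigma_of Z).
Proof.
exact: (@measurableI _ (g_sigma_algebraType
  (\bigcup_i preimage_set_system setT (Z i) measurable))).
Qed.

Lemma sigma_of_bigcap (K : finType) (Z : K -> T -> R) (D : {set K})
    (B : K -> set R) : (forall k, measurable (B k)) ->
  sigma_of Z (\bigcap_(k in [set` D]) (Z k @^-1` B k)).
Proof.
move=> mB.
apply: (@fin_bigcap_measurable _ (g_sigma_algebraType
  (\bigcup_i preimage_set_system setT (Z i) measurable))) => // k _.
exact: sigma_of_preimage.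
Qed.

Lemma leave_one_out_measurable q : leave_one_out q `<=` measurable.
Proof.
move=> _ [B [F [mB sF ->]]]; apply: measurableI.
  by apply: (sigma_of_measurable mX); exact: sigma_of_bigcap.
by apply: (sigma_of_measurable mY).
Qed.

Lemma leave_one_out_setI q : setI_closed (leave_one_out q).
Proof.
move=> _ _ [B [F [mB sF ->]]] [B' [F' [mB' sF' ->]]].
exists (fun k => B k `&` B' k), (F `&` F'); split.
- by move=> k; exact: measurableI.
- exact: sigma_of_setI.
- by rewrite setIACA -bigcapI.
Qed.

Lemma leave_one_out_setT q : leave_one_out q setT.
Proof.
exists (fun=> setT), setT; split=> //; first exact: sigma_of_setT.
by rewrite setIT; apply/esym; rewrite -subTset => t _ k.
Qed.

(** Inserting [C] as the missing side [q] turns the intersection into a full rectangle in the [X k],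
    met with an event of [Y]; [XY] and then [indX] factor it. *)
Lemma leave_one_out_gen_indep q E C : leave_one_out q E -> measurable C ->
  (P (E `&` X q @^-1` C) = P E * P (X q @^-1` C))%E.
Proof.
move=> [B [F [mB sF ->]]] mC.
pose B' k := if k == q then C else B k.
have mB' k : measurable (B' k) by rewrite /B'; case: ifPn.
have B'q : B' q = C by rewrite /B' eqxx.
have -> : \bigcap_(k in [set` ~: [set q]%SET]) X k @^-1` B k `&` F
    `&` X q @^-1` C = \bigcap_(k in [set` [set: I]%SET]) X k @^-1` B' k `&` F.
  apply/seteqP; split => t.
    move=> [[h Ft] Ct]; split=> // k _; rewrite /B' /=.
    by case: eqVneq => [->//|kq]; apply: h; rewrite /= !inE.
  move=> [h Ft]; split; last by have := h q; rewrite /= B'q; apply; rewrite inE.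
  split=> // k /=; rewrite !inE => kq.
  by have := h k; rewrite /B' /= (negbTE kq); apply; rewrite inE.
rewrite XY//; last exact: sigma_of_bigcap.
rewrite XY//; last exact: sigma_of_bigcap.
rewrite indX// indX// (bigD1 q) ?inE//= B'q -muleA muleC; congr (_ * _ * _)%E.
apply: eq_big => [k|k]; first by rewrite !inE.
by rewrite inE /B' => /andP[_ /negbTE ->].
Qed.

Lemma leave_one_out_indep q E C : <<s leave_one_out q >> E -> measurable C ->
  (P (E `&` X q @^-1` C) = P E * P (X q @^-1` C))%E.
Proof.
move=> sE mC.
have mD : measurable (X q @^-1` C) by rewrite -[_ @^-1` _]setTI; exact: mX.
have fD : P (X q @^-1` C) \is a fin_num by exact: fin_num_measure.
pose c : {nonneg R} := NngNum (fine_ge0 (measure_ge0 P (X q @^-1` C))).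
have cE : (c%:num%:E = P (X q @^-1` C))%E by rewrite -[RHS]fineK.
have := @g_sigma_algebra_measure_unique _ _ _ (leave_one_out q)
  (@leave_one_out_measurable q) (fun=> setT) (fun=> leave_one_out_setT q)
  _ (mrestr P mD) (mscale c P) (@leave_one_out_setI q) _ _ E sE.
have m2E A : mscale c P A = (P A * P (X q @^-1` C))%E.
  by rewrite -cE muleC.
move=> key; apply: etrans (m2E E); apply: key.
- by rewrite bigcup_const.
- move=> A /leave_one_out_gen_indep -/(_ _ mC) AC.
  exact: etrans AC (esym (m2E A)).
- move=> _; apply: (@le_lt_trans _ _ (P (X q @^-1` C))).
    by rewrite -[X in (P X)]setTI; exact: lexx.
  by rewrite (le_lt_trans (probability_le1 P mD))// ltry.
Qed.

Lemma measurable_leave_one_out_X q k : k != q ->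
  measurable_fun setT (X k : g_sigma_algebraType (leave_one_out q) -> R).
Proof.
move=> kq _ B mB; rewrite setTI; apply: sub_sigma_algebra.
exists (fun l => if l == k then B else setT), setT; split.
- by move=> l; case: ifPn.
- exact: sigma_of_setT.
- rewrite setIT; apply/seteqP; split=> t.
    by move=> Bt l _ /=; case: eqVneq => // ->.
  by move=> /(_ k); rewrite /= eqxx; apply; rewrite !inE.
Qed.

Lemma measurable_leave_one_out_Y q j :
  measurable_fun setT (Y j : g_sigma_algebraType (leave_one_out q) -> R).
Proof.
move=> _ B mB; rewrite setTI; apply: sub_sigma_algebra.
exists (fun=> setT), (Y j @^-1` B); split=> //; first exact: sigma_of_preimage.
by apply/seteqP; split=> t; [move=> Bt; split|case].
Qed.

End leave_one_out_independence.

(** * Smooth bump functions *)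

Section bump.
Context {R : realType}.
Implicit Types (f g : R -> R) (x a b C : R) (k : nat).

Lemma is_derive_quadratic_bound f C :
  (forall h, `|f h| <= C * h ^+ 2) -> is_derive (0 : R) (1 : R) f 0.
Proof.
move=> fC.
have f0 : f 0 = 0.
  by apply/eqP; rewrite -normr_le0 (le_trans (fC 0))// expr0n mulr0.
have C0 : 0 <= C by have := fC 1; rewrite expr1n mulr1; apply: le_trans.
suff h : (fun h : R => h^-1 *: ((f \o shift 0) (h *: (1 : R)) - f 0)) @ 0^' --> (0 : R).
  by apply: DeriveDef; [apply/cvg_ex; exists 0|exact/cvg_lim].
apply/cvgr0Pnorm_le => e e0.
near=> h.
have hn0 : h != 0 by near: h; exact: nbhs_dnbhs_neq.
rewrite /= f0 subr0 addr0 [_ *: 1]mulr1 normrZ normfV.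
rewrite ler_pdivrMl ?normr_gt0//; apply: le_trans (fC h) _.
rewrite -(real_normK (num_real h)) expr2 mulrA mulrC ler_wpM2l//.
have : `|h| <= e / (C + 1).
  near: h; apply: dnbhs0_le; rewrite divr_gt0//; lra.
rewrite ler_pdivlMr; last lra.
apply: le_trans; rewrite mulrC ler_wpM2l//; lra.
Unshelve. all: by end_near. Qed.

(** The function [x^(-k) exp (-1/x)] extended by 0. The index [k] makes the family stable: the
    derivative is [x^(-k-2) exp (-1/x) - k x^(-k-1) exp (-1/x)]. *)
Definition flat k x : R := if 0 < x then x^-1 ^+ k * expR (- x^-1) else 0.

Lemma flat_ge0 k x : 0 <= flat k x.
Proof.
by rewrite /flat; case: ifPn => // x0; rewrite mulr_ge0 ?expR_ge0// exprn_ge0// invr_ge0 ltW.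
Qed.

(** With [u = 1 / x], the exponential series gives [u^(k+2) <= (k+2)! exp u]. A quadratic bound is
    what [is_derive_quadratic_bound] requires to differentiate at the gluing point 0. *)
Lemma flat_quadratic k x : `|flat k x| <= k.+2`!%:R * x ^+ 2.
Proof.
rewrite ger0_norm ?flat_ge0// /flat; case: ifPn => [x0|_]; last first.
  by rewrite mulr_ge0// sqr_ge0.
have u0 : 0 <= x^-1 by rewrite invr_ge0 ltW.
have := expR_ge1Dxn k.+1 u0.
set u := x^-1; set N : R := k.+2`!%:R => h.
have N0 : 0 < N by rewrite ltr0n fact_gt0.
have : u ^+ k.+2 <= N * expR u.
  rewrite -ler_pdivrMl// mulrC; apply: le_trans h; lra.
move=> {}h.
rewrite expRN ler_pdivrMr ?expR_gt0//.
have -> : u ^+ k = x ^+ 2 * u ^+ k.+2.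
  by rewrite /u -[k.+2]addn2 exprD mulrCA -exprMn divff ?gt_eqF// expr1n mulr1.
by rewrite [leRHS]mulrAC [leRHS]mulrC ler_wpM2l ?sqr_ge0.
Qed.

Lemma is_derive_flat k x :
  is_derive x (1 : R) (flat k) (flat k.+2 x - k%:R * flat k.+1 x).
Proof.
have [x0|x0|->] := ltgtP x 0.
- have -> : flat k.+2 x - k%:R * flat k.+1 x = 0.
    by rewrite /flat ltNge (ltW x0)/= mulr0 subr0.
  apply: (@near_eq_is_derive _ _ _ (cst 0)).
  near=> y; rewrite /flat ifF//; apply/negbTE; rewrite -leNgt ltW//.
  by near: y; apply: open_nbhs_nbhs; split=> //; exact: open_lt.
- apply: (@near_eq_is_derive R R^o R^o (fun y : R => y^-1 ^+ k * expR (- y^-1))).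
    near=> y; rewrite /flat ifT//.
    by near: y; apply: open_nbhs_nbhs; split=> //; exact: open_gt.
  rewrite /flat x0.
  have xn0 : x != 0 by rewrite gt_eqF.
  have dV : is_derive x (1 : R) (fun y : R => y^-1) (- x ^- 2).
    have := @is_deriveV R id x 1 1 xn0 (is_derive_id _ _).
    by rewrite [X in is_derive _ _ _ X]mulr1.
  have dE : is_derive x (1 : R) (fun y : R => expR (- y^-1)) (expR (- x^-1) * x ^- 2).
    apply: (@is_derive1_comp _ expR (fun y => - y^-1)).
    by rewrite -[X in is_derive _ _ _ X]opprK; exact: is_deriveN.
  have dX : is_derive x (1 : R) (fun y : R => y^-1 ^+ k) (- (k%:R * x^-1 ^+ k.+1)).
    have := @is_deriveX _ _ (fun y : R => y^-1) k x 1 _ dV.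
    rewrite exprfctE => h; apply: (is_derive_eq h); rewrite scalerN; congr (- _).
    rewrite -[_ *: _]/(_ * _) -mulrA -exprVn -exprD.
    by case: k {x0 xn0 dV dE h} => [|k]; rewrite ?mul0r// addn2.
  apply: (is_derive_eq (is_deriveM dX dE)).
  rewrite -![_ *: _]/(_ * _) -exprVn -[k.+2]addn2 exprD; ring.
- have -> : flat k.+2 0 - k%:R * flat k.+1 0 = 0 :> R.
    by rewrite /flat ltxx mulr0 subr0.
  exact: is_derive_quadratic_bound (flat_quadratic k).
Unshelve. all: by end_near. Qed.

End bump.

Section bump_function.
Context {R : realType}.
Variables a b : R.
Hypothesis ab : a < b.
Implicit Types (f g : R -> R) (x : R) (k : nat).

(* Closed under differentiation, hence made of smooth functions. *)
Inductive flat_algebra : (R -> R) -> Prop :=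
| FlatL k : flat_algebra (fun x => flat k (x - a))
| FlatR k : flat_algebra (fun x => flat k (b - x))
| FlatD f g : flat_algebra f -> flat_algebra g -> flat_algebra (f \+ g)
| FlatM f g : flat_algebra f -> flat_algebra g -> flat_algebra (f \* g)
| FlatZ c f : flat_algebra f -> flat_algebra (fun x => c * f x).

Lemma is_derive_flatL k x : is_derive x (1 : R) (fun x => flat k (x - a))
  (flat k.+2 (x - a) - k%:R * flat k.+1 (x - a)).
Proof.
rewrite -[X in is_derive _ _ _ X]mulr1.
apply: (@is_derive1_comp _ (flat k) (fun x => x - a)).
  exact: is_derive_flat.
by apply: is_derive_eq; rewrite subr0.
Qed.

Lemma is_derive_flatR k x : is_derive x (1 : R) (fun x => flat k (b - x))
  (-1 * flat k.+2 (b - x) + k%:R * flat k.+1 (b - x)).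
Proof.
have -> : -1 * flat k.+2 (b - x) + k%:R * flat k.+1 (b - x) =
  (flat k.+2 (b - x) - k%:R * flat k.+1 (b - x)) * -1 by ring.
apply: (@is_derive1_comp _ (flat k) (fun x => b - x)).
  exact: is_derive_flat.
by apply: is_derive_eq; rewrite add0r mul1r.
Qed.

Lemma flat_algebra_derive f : flat_algebra f ->
  exists2 g, flat_algebra g & forall x, is_derive x (1 : R) f (g x).
Proof.
elim=> [k|k|f1 f2 _ [g1 G1 d1] _ [g2 G2 d2]|f1 f2 F1 [g1 G1 d1] F2 [g2 G2 d2]
       |c f1 _ [g1 G1 d1]].
- exists ((fun x => flat k.+2 (x - a)) \+ (fun x => - k%:R * flat k.+1 (x - a))).
    by apply: FlatD; [exact: FlatL|apply: FlatZ; exact: FlatL].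
  by move=> x /=; rewrite mulNr; exact: is_derive_flatL.
- exists ((fun x => -1 * flat k.+2 (b - x)) \+ (fun x => k%:R * flat k.+1 (b - x))).
    by apply: FlatD; apply: FlatZ; exact: FlatR.
  by move=> x /=; exact: is_derive_flatR.
- exists (g1 \+ g2); first exact: FlatD.
  by move=> x; exact: is_deriveD.
- exists ((f1 \* g2) \+ (f2 \* g1)); first by apply: FlatD; exact: FlatM.
  by move=> x; exact: is_deriveM.
- exists (fun x => c * g1 x); first exact: FlatZ.
  by move=> x; exact: is_deriveZ.
Qed.

Lemma flat_algebra_smooth f : flat_algebra f ->
  forall k x, derivable (derive1n k f) x 1.
Proof.
move=> Ff k; suff : flat_algebra (derive1n k f).
  by move=> /flat_algebra_derive[g _ fg] x; have [] := fg x.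
elim: k => [//|k /flat_algebra_derive[g Fg fg]].
rewrite derive1nS (_ : derive1 _ = g)//; apply/funext => x.
by rewrite derive1E; have [] := fg x.
Qed.

Definition bump x := flat 0 (x - a) * flat 0 (b - x).

Definition dbump x :=
  flat 2 (x - a) * flat 0 (b - x) - flat 0 (x - a) * flat 2 (b - x).

Lemma bump_ge0 x : 0 <= bump x.
Proof. by rewrite mulr_ge0 ?flat_ge0. Qed.

Lemma bump_out x : ~~ (a < x < b) -> bump x = 0.
Proof.
by rewrite /bump /flat !subr_gt0; case: (ltP a x) => ?; case: (ltP x b) => ? //= _; rewrite ?mulr0 ?mul0r.
Qed.

Lemma dbump_out x : ~~ (a < x < b) -> dbump x = 0.
Proof.
by rewrite /dbump /flat !subr_gt0; case: (ltP a x) => ?; case: (ltP x b) => ? //= _;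
  rewrite ?mulr0 ?mul0r ?subr0.
Qed.

Lemma bump_gt0 x : a < x < b -> 0 < bump x.
Proof.
by move=> /andP[ax xb]; rewrite /bump /flat !subr_gt0 ax xb !expr0 !mul1r mulr_gt0 ?expR_gt0.
Qed.

Lemma is_derive_bump x : is_derive x (1 : R) bump (dbump x).
Proof.
apply: (is_derive_eq (is_deriveM (is_derive_flatL 0 x) (is_derive_flatR 0 x))).
by rewrite -![_ *: _]/(_ * _) /dbump !mul0r addr0 subr0; ring.
Qed.

Lemma derive1_bump : derive1 bump = dbump.
Proof.
by apply/funext => x; rewrite derive1E; have [] := is_derive_bump x.
Qed.

Lemma test_function_bump : test_function bump.
Proof.
split; first by apply: flat_algebra_smooth; apply: FlatM; [exact: FlatL|exact: FlatR].
apply: (@subclosed_compact _ _ `[a, b]%classic).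
- exact: closed_closure.
- exact: segment_compact.
rewrite [X in _ `<=` X](closure_id _).1; last exact: interval_closed.
apply: closureS => x /= /eqP; apply: contra_notP => xab; apply: bump_out.
by apply: contra_notN xab => /andP[ax xb]; rewrite /= in_itv/= !ltW.
Qed.

Lemma continuous_bump : continuous bump.
Proof.
move=> x; apply: differentiable_continuous; apply/derivable1_diffP.
by have [] := is_derive_bump x.
Qed.

Lemma continuous_dbump : continuous dbump.
Proof.
move=> x; apply: differentiable_continuous; apply/derivable1_diffP.
rewrite -derive1_bump -[derive1 _]/(derive1n 1 bump); apply: flat_algebra_smooth.
by apply: FlatM; [exact: FlatL|exact: FlatR].
Qed.

(** The second factor is the logarithmic derivative of the bump; it changes sign exactly at the
    midpoint. *)
Lemma dbumpE x : a < x < b ->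
  dbump x = bump x * ((x - a)^-1 ^+ 2 - (b - x)^-1 ^+ 2).
Proof.
move=> /andP[ax xb].
by rewrite /dbump /bump /flat !subr_gt0 ax xb !expr0 !mul1r; ring.
Qed.

Lemma dbump_ge0 x : x <= (a + b) / 2 -> 0 <= dbump x.
Proof.
move=> xm; have [axb|/dbump_out ->//] := boolP (a < x < b).
rewrite dbumpE// mulr_ge0 ?bump_ge0// subr_ge0; move/andP: axb => [ax xb].
by rewrite lerXn2r ?nnegrE ?invr_ge0 ?subr_ge0 ?(ltW ax) ?(ltW xb)// lef_pV2 ?posrE ?subr_gt0//; lra.
Qed.

Lemma dbump_le0 x : (a + b) / 2 <= x -> dbump x <= 0.
Proof.
move=> xm; have [axb|/dbump_out ->//] := boolP (a < x < b).
rewrite dbumpE// mulr_ge0_le0 ?bump_ge0// subr_le0; move/andP: axb => [ax xb].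
by rewrite lerXn2r ?nnegrE ?invr_ge0 ?subr_ge0 ?(ltW ax) ?(ltW xb)// lef_pV2 ?posrE ?subr_gt0//; lra.
Qed.

End bump_function.

(** * Lipschitz bound from the weak derivative *)

Section weak_derivative_slope.
Context {R : realType}.
Implicit Types (f g : R -> R) (a b L s : R).
Local Notation mu := (@lebesgue_measure R).

Lemma integral_bump_gt0 a b : a < b ->
  (0 < \int[mu]_(x in `[a, b]) (bump a b x)%:E)%E.
Proof.
move=> ab; have mB : measurable_fun (`[a, b] : set R) (EFin \o bump a b).
  apply/measurable_EFinP; apply: measurable_funTS.
  by apply: continuous_measurable_fun; exact: continuous_bump.
rewrite lt_neqAle eq_sym integral_ge0 ?andbT; last first.
  by move=> x _; rewrite lee_fin bump_ge0.
apply/eqP => I0.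
have /(ae_eq_integral_abs mu (measurable_itv _) mB) : 
    (\int[mu]_(x in `[a, b]) `|(EFin \o bump a b) x| = 0)%E.
  by rewrite -[RHS]I0; apply: eq_integral => x _; rewrite gee0_abs// lee_fin bump_ge0.
move=> [N [mN N0 sN]].
have : (mu `]a, b[%classic <= mu N)%E.
  apply: le_measure; rewrite ?inE//; apply: subset_trans sN => x /=.
  rewrite in_itv/= => axb /=; apply/not_implyP; split.
    by case/andP: axb => ax xb; rewrite in_itv/= !ltW.
  by move=> [] /eqP; rewrite gt_eqF// bump_gt0.
rewrite N0 lebesgue_measure_itv/= lte_fin ab -EFinB lee_fin; lra.
Qed.

Lemma integral_restrict_itv a b (F : R -> \bar R) :
  (forall x, ~~ (a < x < b) -> F x = 0%E) ->
  (\int[mu]_x F x = \int[mu]_(x in `[a, b]) F x)%E.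
Proof.
move=> F0; rewrite [RHS]integral_mkcond; congr (integral _ _ _).
apply/funext => x; rewrite patchE; case: ifPn => // xab; rewrite F0//.
apply: contraNN xab => /andP[ax xb]; rewrite inE/= in_itv/= !ltW//.
Qed.

Lemma locally_integrable_itv f a b : locally_integrable setT f ->
  mu.-integrable `[a, b] (EFin \o f).
Proof.
move=> [mf _ fK]; apply/integrableP; split.
  by apply/measurable_EFinP; exact: measurable_funTS.
by apply: fK => //; exact: segment_compact.
Qed.

Lemma continuous_bounded_itv f a b : continuous f ->
  [bounded f x | x in `[a, b]%classic].
Proof.
move=> cf; have cw : {within `[a, b], continuous f} by exact: continuous_subspaceT.
have /compact_bounded[M [_ mrt]] := continuous_compact cw (@segment_compact R a b).
by exists M; split; rewrite ?num_real // => ? ? ? ?; exact: mrt.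
Qed.

Lemma integrable_mul_continuous f h a b : locally_integrable setT f ->
  continuous h -> mu.-integrable `[a, b] (fun x => (f x * h x)%:E).
Proof.
move=> /(@locally_integrable_itv _ a b)/integrableMl fh ch.
apply: fh; last exact: continuous_bounded_itv.
- exact: measurable_itv.
- by apply: measurable_funTS; exact: continuous_measurable_fun.
Qed.

Lemma integral_mulN f h a b : locally_integrable setT f -> continuous h ->
  (\int[mu]_(x in `[a, b]) (- f x * h x)%:E =
   - \int[mu]_(x in `[a, b]) (f x * h x)%:E)%E.
Proof.
move=> lf ch; rewrite -integralN; last first.
  exact/integrable_add_def/integrable_mul_continuous.
by apply: eq_integral => x _; rewrite mulNr EFinN.
Qed.

(* The bump increases up to the midpoint [m] of the interval and decreases
   afterwards, so [(h x - h m) * dbump x <= 0] for the nondecreasing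
   [h x = f x - s * x]. *)
Lemma bump_slope_le f g L s a b : a < b -> 0 <= L ->
  locally_integrable setT f -> locally_integrable setT g ->
  (\int[mu]_(x in `[a, b]) (f x * dbump a b x)%:E =
   - \int[mu]_(x in `[a, b]) (g x * bump a b x)%:E)%E ->
  {ae mu, forall x, `|g x| <= L} ->
  (forall x y, a <= x -> x <= y -> y <= b -> s * (y - x) <= f y - f x) ->
  s <= L.
Proof.
move=> ab L0 lf lg E gL fs.
pose phi := bump a b; pose dphi := dbump a b.
pose m := (a + b) / 2; pose c := f m - s * m.
pose J := (\int[mu]_(x in `[a, b]) (phi x)%:E)%E.
have J0 : (0 < J)%E by exact: integral_bump_gt0.
have cphi : continuous phi by exact: continuous_bump.
have cdphi : continuous dphi by exact: continuous_dbump.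
have mphi : measurable_fun (`[a, b] : set R) phi.
  by apply: measurable_funTS; exact: continuous_measurable_fun.
have mdphi : measurable_fun (`[a, b] : set R) dphi.
  by apply: measurable_funTS; exact: continuous_measurable_fun.
have iphi : mu.-integrable `[a, b] (EFin \o phi).
  apply: continuous_compact_integrable; first exact: segment_compact.
  exact: continuous_subspaceT.
have Jfin : J \is a fin_num by exact: integrable_fin_num.
have lower : (- (L%:E * J) <= \int[mu]_(x in `[a, b]) (f x * dphi x)%:E)%E.
  rewrite E leeN2.
  have mgp : measurable_fun (`[a, b] : set R) (fun x => (g x * phi x)%:E).
    exact: measurable_int _ (@integrable_mul_continuous g phi a b lg cphi).
  apply: le_trans (lee_abs _) _.
  apply: le_trans (le_abse_integral mu (measurable_itv _) mgp) _.
  rewrite /J -integralZl//; apply: ae_ge0_le_integral => //.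
  - exact: measurableT_comp.
  - by move=> x _; rewrite /= -EFinM lee_fin mulr_ge0// bump_ge0.
  - by apply/measurable_EFinP; exact: measurable_funM.
  - move: gL; apply: filterS; first exact: (ae_filter_ringOfSetsType mu).
    move=> x gx _; rewrite -EFinM lee_fin normrM.
    by rewrite [X in _ * X]ger0_norm ?bump_ge0// ler_wpM2r ?bump_ge0.
(* [c] makes the line [s * x + c] meet [f] at the midpoint. Since [f] minus the line and [dphi] have
   opposite signs, replacing [f] by the line can only raise the integral; integrating the line by
   parts gives [- s * J]. *)
have upper : (\int[mu]_(x in `[a, b]) (f x * dphi x)%:E <= - (s%:E * J))%E.
  have line_cont : continuous (fun x : R => s * x + c).
    move=> x; apply: cvgD; last exact: cvg_cst.
    by apply: cvgM; [exact: cvg_cst|exact: cvg_id].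
  apply: (@le_trans _ _ (\int[mu]_(x in `[a, b]) ((s * x + c) * dphi x)%:E)%E).
    apply: le_integral.
    - exact: measurable_itv.
    - exact: integrable_mul_continuous.
    - apply: continuous_compact_integrable; first exact: segment_compact.
      by apply: continuous_subspaceT => x; apply: cvgM; [exact: line_cont|exact: cdphi].
    - move=> x; rewrite inE/= in_itv/= => /andP[ax xb]; rewrite lee_fin.
      have [xm|xm] := lerP x m.
        have := fs x m ax xm; have := @dbump_ge0 R a b x xm; rewrite -/dphi /c.
        have : m <= b by rewrite /m; lra.
        nra.
      have := fs m x _ (ltW xm) xb; have := @dbump_le0 R a b x (ltW xm); rewrite -/dphi /c.
      have : a <= m by rewrite /m; lra.
      nra.
  rewrite (@integration_by_parts _ (fun x => s * x + c) phi (cst s) dphi)//.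
  - rewrite /phi !bump_out ?ltxx ?andbF// !mulr0 subr0 add0e leeN2 /J -integralZl//.
  - by apply: continuous_subspaceT => x; exact: cvg_cst.
  - split.
    + by move=> x _; apply: ex_derive.
    + apply: cvg_at_right_filter; exact: line_cont.
    + apply: cvg_at_left_filter; exact: line_cont.
  - by move=> x _; rewrite derive1E derive_val addr0 [_%:A]mulr1.
  - exact: continuous_subspaceT.
  - split.
    + by move=> x _; have [] := @is_derive_bump R a b x.
    + apply: cvg_at_right_filter; exact: cphi.
    + apply: cvg_at_left_filter; exact: cphi.
  - by move=> x _; rewrite derive1_bump.
have := le_trans lower upper.
rewrite leeN2 -(fineK Jfin) -!EFinM lee_fin ler_pM2r//.
by rewrite -lte_fin fineK.
Qed.

Lemma bump_slope_ge f g L s a b : a < b -> 0 <= L ->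
  locally_integrable setT f -> locally_integrable setT g ->
  (\int[mu]_(x in `[a, b]) (f x * dbump a b x)%:E =
   - \int[mu]_(x in `[a, b]) (g x * bump a b x)%:E)%E ->
  {ae mu, forall x, `|g x| <= L} ->
  (forall x y, a <= x -> x <= y -> y <= b -> f y - f x <= s * (y - x)) ->
  - L <= s.
Proof.
move=> ab L0 lf lg E gL fs; rewrite lerNl.
apply: (@bump_slope_le (\- f) (\- g) _ _ _ _ ab L0).
- exact: locally_integrableN.
- exact: locally_integrableN.
- rewrite (integral_mulN _ _ lf); last exact: continuous_dbump.
  by rewrite (integral_mulN _ _ lg) ?E//; exact: continuous_bump.
- move: gL; apply: filterS; first exact: (ae_filter_ringOfSetsType mu).
  by move=> x; rewrite normrN.
- move=> x y ax xy yb; have := fs x y ax xy yb; rewrite /=; lra.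
Qed.

Lemma weak_derivative_bump f g a b : a < b -> is_weak_derivative f g ->
  (\int[mu]_(x in `[a, b]) (f x * dbump a b x)%:E =
   - \int[mu]_(x in `[a, b]) (g x * bump a b x)%:E)%E.
Proof.
move=> ab [_ _ fg].
have := fg (bump a b) (test_function_bump a b).
rewrite derive1_bump (@integral_restrict_itv a b); last first.
  by move=> x xab; rewrite dbump_out// mulr0.
by rewrite (@integral_restrict_itv a b)// => x xab; rewrite bump_out// mulr0.
Qed.

Lemma convex_function_chord f x y z : convex_function (setT : set R) f ->
  x < y -> y < z ->
  (f y - f x) / (y - x) <= (f z - f y) / (z - y).
Proof.
move=> cf xy yz.
have t0 : 0 <= (z - y) / (z - x) <= 1.
  by rewrite divr_ge0/= ?ler_pdivrMr; lra.
have := cf (Itv01 (andP t0).1 (andP t0).2) x z.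
rewrite !inE => /(_ I I).
set t := (z - y) / (z - x).
(* This unfolds the abstract convex combination into arithmetic; the weight goes to the first
   point. *)
change (f (t * x + (1 - t) * z) <= t * f x + (1 - t) * f z ->
  (f y - f x) / (y - x) <= (f z - f y) / (z - y)).
have zx : z - x != 0 by lra.
have -> : t * x + (1 - t) * z = y by rewrite /t; field.
have -> : t * f x + (1 - t) * f z =
    ((z - y) * f x + (y - x) * f z) / (z - x) by rewrite /t; field.
rewrite ler_pdivlMr; last lra.
move=> h; rewrite ler_pdivrMr; last lra.
rewrite mulrAC ler_pdivlMr; last lra.
lra.
Qed.

Lemma convex_function_slope_right f a b x y :
  convex_function (setT : set R) f -> a < b -> b <= x -> x <= y ->
  (f b - f a) / (b - a) * (y - x) <= f y - f x.
Proof.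
move=> cf ab; rewrite le_eqVlt => /predU1P[<-|bx]; rewrite le_eqVlt => /predU1P[<-|xy].
- by rewrite !subrr mulr0.
- by rewrite -ler_pdivlMr ?subr_gt0//; exact: convex_function_chord.
- by rewrite !subrr mulr0.
- rewrite -ler_pdivlMr ?subr_gt0//.
  apply: (@le_trans _ _ ((f x - f b) / (x - b))); exact: convex_function_chord.
Qed.

Lemma convex_function_slope_left f a b x y :
  convex_function (setT : set R) f -> a < b -> x <= y -> y <= a ->
  f y - f x <= (f b - f a) / (b - a) * (y - x).
Proof.
move=> cf ab; rewrite le_eqVlt => /predU1P[<-|xy]; rewrite le_eqVlt => /predU1P[ya|ya].
- by rewrite !subrr mulr0.
- by rewrite !subrr mulr0.
- move: xy; rewrite ya => xa.
  by rewrite -ler_pdivrMr ?subr_gt0//; exact: convex_function_chord.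
- rewrite -ler_pdivrMr ?subr_gt0//.
  apply: (@le_trans _ _ ((f a - f y) / (a - y))); exact: convex_function_chord.
Qed.

(** By convexity the slope of the chord over [[a, b]] bounds the increments of [f] from below to the
    right of [b] and from above to the left of [a]. Bumps on [[b, b + 1]] and [[a - 1, a]] compare
    that slope with the almost everywhere bound on [g]. *)
Lemma condM2_lipschitz f L : condM2 f L -> forall x y, `|f x - f y| <= L * `|x - y|.
Proof.
move=> [cf L0 [g [wf gL]]].
have {}gL : {ae mu, forall x, `|g x| <= L}.
  have /ess_supP : (ess_sup mu (fun x => `|g x|%:E) <= L%:E)%E.
    by apply: le_trans gL; rewrite le_max lexx orbT.
  by apply: filterS => x; rewrite lee_fin.
have [lf lg _] := wf.
have main a b : a < b -> `|f b - f a| <= L * (b - a).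
  move=> ab; rewrite -ler_pdivrMr ?subr_gt0//.
  have -> : `|f b - f a| / (b - a) = `|(f b - f a) / (b - a)|.
    by rewrite normrM normfV [`|b - a|]gtr0_norm ?subr_gt0.
  rewrite ler_norml; apply/andP; split.
  - have aa : a - 1 < a by lra.
    apply: (bump_slope_ge aa (ltW L0) lf lg (weak_derivative_bump aa wf) gL).
    by move=> x y _ xy ya; exact: convex_function_slope_left.
  - have bb : b < b + 1 by lra.
    apply: (bump_slope_le bb (ltW L0) lf lg (weak_derivative_bump bb wf) gL).
    by move=> x y bx xy _; exact: convex_function_slope_right.
move=> x y; have [xy|xy|->] := ltgtP x y.
- by rewrite distrC [`|x - y|]distrC [`|y - x|]gtr0_norm ?subr_gt0// main.
- by rewrite [`|x - y|]gtr0_norm ?subr_gt0// main.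
- by rewrite !subrr normr0 mulr0.
Qed.

End weak_derivative_slope.

(** * Leave-one-out relaxation *)

(** Otherwise [h (h - a) > (b + c)^2 >= b^2 + c^2]. *)
Lemma le_of_sqr_le {R : realFieldType} (h a b c : R) :
  0 <= h -> 0 <= a -> 0 <= b -> 0 <= c ->
  h ^+ 2 <= h * a + b ^+ 2 + c ^+ 2 -> h <= a + b + c.
Proof. by move=> h0 a0 b0 c0 hh; rewrite leNgt; apply/negP => lt; nra. Qed.

Section relaxed_leave_one_out.
Context {R : realType} {m n : nat}.
Variables (psi : R -> R) (L lambda eps : R) (mu : 'cV[R]_n) (j : 'I_n).
Hypothesis psi_lip : forall x y, `|psi x - psi y| <= L * `|x - y|.
Hypothesis psi_convex : forall t x y, 0 <= t -> t <= 1 ->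
  psi (x + t * (y - x)) <= psi x + t * (psi y - psi x).
Hypothesis L0 : 0 < L.
Hypothesis lambda0 : 0 < lambda.
Hypothesis eps0 : 0 < eps.
Implicit Types (A : 'M[R]_(m, n)) (xi : 'cV[R]_m) (w : 'I_n -> R) (r : 'I_m -> R).

Definition loo_residual A xi w r i :=
  \sum_(k | k != j) A i k * w k - xi i 0 - r i.

(* Column [j] of [A] and the coordinate [w j] play no role. *)
Definition relaxed_loss A xi w r : R :=
  \sum_i psi (loo_residual A xi w r i)
  + ((2 * eps)^-1 * \sum_i r i ^+ 2
     + lambda / 2 * \sum_(k | k != j) (w k + mu k 0) ^+ 2).

Definition relaxed_gap A xi w r eta :=
  forall w' r', relaxed_loss A xi w r <= relaxed_loss A xi w' r' + eta.

(** The competitor moves the single slack [r i] towards 0 by [eps * L]. The loss [psi] rises by at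
    most [eps * L^2], whereas the penalty drops by [|r i| * L - eps * L^2 / 2]; with the gap this
    gives [5/2 * eps * L], rounded up to 3. *)
Lemma relaxed_gap_dual_bound A xi w r eta : eta <= eps * L ^+ 2 ->
  relaxed_gap A xi w r eta -> forall i, `|r i| <= 3 * eps * L.
Proof.
move=> etaL gap i.
pose s := Num.sg (r i) * (eps * L).
pose r' k := if k == i then r i - s else r k.
have r'i : r' i = r i - s by rewrite /r' eqxx.
have r'k k : k != i -> r' k = r k by move=> /negbTE ki; rewrite /r' ki.
have resi : loo_residual A xi w r' i = loo_residual A xi w r i + s.
  by rewrite /loo_residual r'i; ring.
have sumr : \sum_k r' k ^+ 2 = \sum_k r k ^+ 2 - (2 * r i * s - s ^+ 2).
  rewrite (bigD1 i)//= [in RHS](bigD1 i)//= r'i.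
  by under eq_bigr => k ki do rewrite r'k//; ring.
have sump : \sum_k psi (loo_residual A xi w r' k) =
    \sum_k psi (loo_residual A xi w r k)
    + (psi (loo_residual A xi w r i + s) - psi (loo_residual A xi w r i)).
  rewrite (bigD1 i)//= [in RHS](bigD1 i)//= resi.
  have -> : \sum_(k < m | k != i) psi (loo_residual A xi w r' k) =
          \sum_(k < m | k != i) psi (loo_residual A xi w r k).
    by apply: eq_bigr => k ki; rewrite /loo_residual r'k.
  by ring.
have := gap w r'; rewrite /relaxed_loss sumr sump.
have := psi_lip (loo_residual A xi w r i + s) (loo_residual A xi w r i).
rewrite ler_norml => /andP[_].
have -> : loo_residual A xi w r i + s - loo_residual A xi w r i = s by ring.
have eL : 0 < eps * L by rewrite mulr_gt0.
have sn : `|s| <= eps * L.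
  rewrite normrM (gtr0_norm eL) ler_piMl ?(ltW eL)// normr_sg.
  by case: (r i == 0) => /=.
have rs : r i * s = `|r i| * (eps * L).
  by rewrite mulrA -[r i * _]mulrC -normrEsg.
have ss : s ^+ 2 <= (eps * L) ^+ 2.
  by rewrite -(real_normK (num_real s)) lerXn2r ?nnegrE ?(ltW eL).
set P1 := psi _; set P2 := psi _; set S1 := \sum_i psi _.
set S2 := \sum_i _ ^+ 2; set S3 := lambda / 2 * _ => h1 h2.
have Ls : L * `|s| <= L * (eps * L) by rewrite ler_pM2l.
have key : (2 * eps)^-1 * (2 * r i * s - s ^+ 2) <= eta + L * (eps * L).
  by rewrite mulrBr in h2; lra.
rewrite mulrC ler_pdivrMr in key; last by rewrite mulr_gt0.
have e1 : 2 * r i * s = 2 * (`|r i| * (eps * L)) by rewrite -mulrA rs.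
rewrite e1 in key.
have k2 : 2 * (`|r i| * (eps * L)) <= (eps * L ^+ 2 + L * (eps * L)) * (2 * eps) + (eps * L) ^+ 2.
  have : (eta + L * (eps * L)) * (2 * eps) <= (eps * L ^+ 2 + L * (eps * L)) * (2 * eps).
    by rewrite ler_pM2r ?mulr_gt0// lerD2r.
  lra.
rewrite -(ler_pM2r eL).
have : 0 < (eps * L) ^+ 2 by rewrite exprn_gt0.
have -> : 3 * eps * L * (eps * L) = 3 * (eps * L) ^+ 2 by ring.
have e2 : (eps * L ^+ 2 + L * (eps * L)) * (2 * eps) = 4 * (eps * L) ^+ 2 by ring.
rewrite e2 in k2; lra.
Qed.

(* This [t] makes the [T] term at most half of [t * lambda / 2 * h ^+ 2]. *)
Lemma coordinate_bound_of_variation (N T X eta D S h muj theta : R)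
    (t := eps * lambda / (4 * (T + eps * lambda))) :
  1 <= N -> 0 <= T -> 0 <= theta -> 28 * N * eps * L ^+ 2 <= lambda * theta ^+ 2 ->
  eta <= eps * L ^+ 2 / N ^+ 2 -> D <= 3 * N * eps * L ^+ 2 ->
  T <= S ^+ 2 -> 0 <= S ->
  0 <= eta + t * (D - lambda / 2 * h ^+ 2 - lambda * h * muj) - t * h * X
         + t ^+ 2 / eps * h ^+ 2 * T ->
  `|h| <= 4 * (`|muj| + `|X| / lambda) + 4 * L / lambda * (S / N) + theta.
Proof.
move=> N1 T0 th0 thE etaE DE TS S0 hyp.
have el : 0 < eps * lambda by rewrite mulr_gt0.
have Tel : 0 < T + eps * lambda by rewrite ltr_wpDl.
have t0 : 0 < t by rewrite divr_gt0// mulr_gt0.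
have N0 : 0 < N by lra.
have := mulr_ge0 (ltW (divr_gt0 ltr01 t0)) hyp.
have tn0 : t != 0 by rewrite gt_eqF.
have en0 : eps != 0 by rewrite gt_eqF.
have ln0 : lambda != 0 by rewrite gt_eqF.
have Nn0 : N != 0 by rewrite gt_eqF.
have -> : 1 / t * (eta + t * (D - lambda / 2 * h ^+ 2 - lambda * h * muj) - t * h * X
         + t ^+ 2 / eps * h ^+ 2 * T) =
   eta / t + (D - lambda / 2 * h ^+ 2 - lambda * h * muj) - h * X + t / eps * T * h ^+ 2.
  by field; rewrite tn0 en0.
have tT : t / eps * T * h ^+ 2 <= lambda / 4 * h ^+ 2.
  rewrite ler_wpM2r ?sqr_ge0//.
  have -> : t / eps * T = lambda / 4 * (T / (T + eps * lambda)).
    by rewrite /t; field; rewrite en0 gt_eqF.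
  rewrite ler_piMr ?divr_ge0 ?(ltW lambda0)// ler_pdivrMr// mul1r lerDl ltW//.
(* The factor [eps] of [eta] cancels the one in [t]. What remains is proportional to [T <= S^2],
   which produces the term in [S / N] of the conclusion. *)
have et : eta / t <= lambda / 4 * (4 * L / lambda * (S / N)) ^+ 2 + 4 * eps * L ^+ 2 / N ^+ 2.
  have -> : eta / t = eta * (4 * (T + eps * lambda) / (eps * lambda)).
    by rewrite /t invf_div.
  apply: (@le_trans _ _ (eps * L ^+ 2 / N ^+ 2 * (4 * (T + eps * lambda) / (eps * lambda)))).
    apply: ler_wpM2r => //; apply: divr_ge0; [apply: mulr_ge0 => //; exact: ltW|exact: ltW].
  have -> : eps * L ^+ 2 / N ^+ 2 * (4 * (T + eps * lambda) / (eps * lambda)) =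
     4 * L ^+ 2 / N ^+ 2 / lambda * T + 4 * eps * L ^+ 2 / N ^+ 2.
    by field; rewrite en0 ln0 Nn0.
  rewrite lerD2r.
  have -> : lambda / 4 * (4 * L / lambda * (S / N)) ^+ 2 = 4 * L ^+ 2 / N ^+ 2 / lambda * S ^+ 2.
    by field; rewrite ln0 Nn0.
  apply: ler_wpM2l => //; apply: divr_ge0; last exact: ltW.
  by apply: divr_ge0; [apply: mulr_ge0 => //|]; exact: sqr_ge0.
have eN : 4 * eps * L ^+ 2 / N ^+ 2 <= 4 * N * eps * L ^+ 2.
  rewrite ler_pdivrMr ?exprn_gt0//.
  have -> : 4 * N * eps * L ^+ 2 * N ^+ 2 = 4 * eps * L ^+ 2 * N ^+ 3 by ring.
  apply: ler_peMr; last exact: exprn_ege1.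
  by apply: mulr_ge0; [apply: mulr_ge0 => //; exact: ltW|exact: sqr_ge0].
pose B := 4 * L / lambda * (S / N); rewrite -/B in et *.
have hmu : - (lambda * h * muj) <= `|h| * (lambda * `|muj|).
  rewrite (_ : _ * (_ * _) = `|lambda * h * muj|); first by rewrite -normrN ler_norm.
  by rewrite !normrM (gtr0_norm lambda0); ring.
have hX : - (h * X) <= `|h| * `|X|.
  by rewrite -normrM -normrN ler_norm.
move=> h1.
have Xl : 0 <= `|X| / lambda by rewrite divr_ge0 ?(ltW lambda0).
apply: le_of_sqr_le => //.
- by rewrite mulr_ge0// addr_ge0.
- by apply: mulr_ge0; apply: divr_ge0 => //; rewrite ?mulr_ge0// ltW.
(* [7 = 3 + 4] adds the bound [DE] on [D] to the remainder [eN]. Factoring out [lambda / 4] turns 7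
   into the 28 of the hypothesis on [theta]. *)
have h2 : lambda / 4 * h ^+ 2 <= lambda / 4 * B ^+ 2 + 7 * N * eps * L ^+ 2
     + `|h| * (lambda * `|muj|) + `|h| * `|X|.
  lra.
rewrite -(ler_pM2l (_ : 0 < lambda / 4)) ?divr_gt0// real_normK ?num_real//.
apply: (le_trans h2).
have -> : lambda / 4 * (`|h| * (4 * (`|muj| + `|X| / lambda)) + B ^+ 2 + theta ^+ 2)
  = `|h| * (lambda * `|muj|) + `|h| * `|X| + lambda / 4 * B ^+ 2 + lambda * theta ^+ 2 / 4.
  by field.
lra.
Qed.

(* Competitors: for the relaxed loss, [w] moved by [t] towards [wh], with slacks
   [rt] making the residuals the convex combination of both residuals; for the
   robust loss, [w] with coordinate [j] set to [0]. *)
Lemma relaxed_gap_coordinate A xi w r eta (theta : R) (wh : 'cV[R]_n) :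
  (0 < m)%N -> 0 <= theta ->
  28 * m%:R * eps * L ^+ 2 <= lambda * theta ^+ 2 ->
  eta <= eps * L ^+ 2 / m%:R ^+ 2 ->
  relaxed_gap A xi w r eta ->
  (forall v, robust_loss psi lambda mu A xi wh <= robust_loss psi lambda mu A xi v) ->
  `|wh j 0| <= 4 * (`|mu j 0| + `|\sum_i (r i / eps) * A i j| / lambda)
     + 4 * L / lambda * ((\sum_i `|A i j|) / m%:R) + theta.
Proof.
move=> m0 th0 thE etaE gap opt.
set h := wh j 0.
have N1 : 1 <= m%:R :> R by rewrite ler1n.
have N0 : 0 < m%:R :> R by rewrite ltr0n.
have etaE' : eta <= eps * L ^+ 2.
  apply: le_trans etaE _; rewrite ler_pdivrMr ?exprn_gt0// ler_peMr ?exprn_ege1//.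
  by rewrite mulr_ge0 ?sqr_ge0 ?(ltW eps0).
have rb := relaxed_gap_dual_bound etaE' gap.
pose T := \sum_i A i j ^+ 2.
pose S := \sum_i `|A i j|.
have T0 : 0 <= T by apply: sumr_ge0 => i _; exact: sqr_ge0.
have S0 : 0 <= S by apply: sumr_ge0.
have TS : T <= S ^+ 2.
  rewrite expr2 /S mulr_suml; apply: ler_sum => i _.
  rewrite -(real_normK (num_real _)) expr2 ler_wpM2l// (bigD1 i)//= lerDl.
  exact: sumr_ge0.
(* Lipschitz cost of dropping the slacks when passing to the second competitor [v0]. *)
pose D := L * \sum_i `|r i|.
have DE : D <= 3 * m%:R * eps * L ^+ 2.
  rewrite /D (_ : 3 * _ * _ * _ = L * \sum_(i < m) (3 * eps * L)); last first.
    by rewrite sumr_const card_ord -mulr_natl; ring.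
  by rewrite ler_pM2l// ler_sum.
apply: (coordinate_bound_of_variation (T := T) (eta := eta) (D := D)) => //.
set t := _ / _.
have el : 0 < eps * lambda by rewrite mulr_gt0.
have t0 : 0 <= t by rewrite divr_ge0 ?(ltW el)// mulr_ge0// addr_ge0// ltW.
have t1 : t <= 1.
  rewrite ler_pdivrMr; last by rewrite mulr_gt0// ltr_wpDl.
  by rewrite mul1r mulrDr; have := ltW el; lra.
clearbody t.
pose wt k := w k + t * (wh k 0 - w k).
pose rt i := r i - t * (r i + A i j * h).
pose zh i := (A *m wh) i 0 - xi i 0.
pose z i := loo_residual A xi w r i.
pose Sa := \sum_(k | k != j) (w k + mu k 0) ^+ 2.
pose Sb := \sum_(k | k != j) (wh k 0 + mu k 0) ^+ 2.
pose PZ := \sum_i psi (z i).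
pose PY := \sum_i psi (zh i).
pose X := \sum_i r i / eps * A i j.
have zhE i : zh i = \sum_(k | k != j) A i k * wh k 0 + A i j * h - xi i 0.
  by rewrite /zh mxE (bigD1 j)//= [X in X - _]addrC.
have ztE i : loo_residual A xi wt rt i = z i + t * (zh i - z i).
  rewrite zhE /z /loo_residual /wt /rt.
  under eq_bigr => k _ do rewrite mulrDr mulrCA mulrBr.
  by rewrite big_split/= -mulr_sumr sumrB; ring.
have gapt := gap wt rt.
have psit : \sum_i psi (loo_residual A xi wt rt i) <= PZ + t * (PY - PZ).
  rewrite /PZ /PY -sumrB mulr_sumr -big_split/=; apply: ler_sum => i _.
  by rewrite ztE; exact: psi_convex.
(* The first-order term in [t] brings in [X], the sum of the [c_i a_i]. In the second-order one,
   [(q + u h)^2 <= 2 q^2 + 2 u^2 h^2], and [2 t^2 q^2] is absorbed by [- 2 t q^2] because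
   [t <= 1]. *)
have rtt : (2 * eps)^-1 * \sum_i rt i ^+ 2 <=
    (2 * eps)^-1 * \sum_i r i ^+ 2 - t * h * X + t ^+ 2 / eps * h ^+ 2 * T.
  have -> : (2 * eps)^-1 * \sum_i r i ^+ 2 - t * h * X + t ^+ 2 / eps * h ^+ 2 * T
    = (2 * eps)^-1 * \sum_i (r i ^+ 2 - 2 * t * h * (r i * A i j)
                             + 2 * t ^+ 2 * h ^+ 2 * A i j ^+ 2).
    rewrite big_split/= sumrB -!mulr_sumr -/T.
    have -> : \sum_i r i * A i j = eps * X.
      by rewrite /X mulr_sumr; apply: eq_bigr => i _; field; rewrite gt_eqF.
    by field; rewrite gt_eqF.
  rewrite ler_wpM2l ?invr_ge0 ?mulr_ge0 ?(ltW eps0)//; apply: ler_sum => i _.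
  rewrite /rt; set u := A i j; set q := r i.
  have q2 : 0 <= (1 - t) * t * q ^+ 2 by apply: mulr_ge0; [apply: mulr_ge0 => //; lra|exact: sqr_ge0].
  have qu : 0 <= t ^+ 2 * (q - u * h) ^+ 2 by apply: mulr_ge0; exact: sqr_ge0.
  rewrite -subr_ge0; have -> : q ^+ 2 - 2 * t * h * (q * u) + 2 * t ^+ 2 * h ^+ 2 * u ^+ 2 -
     (q - t * (q + u * h)) ^+ 2
     = 2 * ((1 - t) * t * q ^+ 2) + t ^+ 2 * (q - u * h) ^+ 2 by ring.
  lra.
have wtt : \sum_(k | k != j) (wt k + mu k 0) ^+ 2 <= Sa + t * (Sb - Sa).
  rewrite /Sa /Sb -sumrB mulr_sumr -big_split/=; apply: ler_sum => k _.
  rewrite /wt; set u := wh k 0; set q := w k; set v := mu k 0.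
  have q2 : 0 <= (1 - t) * t * (u - q) ^+ 2 by apply: mulr_ge0; [apply: mulr_ge0 => //; lra|exact: sqr_ge0].
  rewrite -subr_ge0; have -> : (q + v) ^+ 2 + t * ((u + v) ^+ 2 - (q + v) ^+ 2)
     - (q + t * (u - q) + v) ^+ 2 = (1 - t) * t * (u - q) ^+ 2 by ring.
  by [].
pose v0 : 'cV[R]_n := \col_k (if k == j then 0 else w k).
have := opt v0.
rewrite /robust_loss (bigD1 j (F := fun k => ((wh + mu) k 0) ^+ 2))//=.
rewrite (bigD1 j (F := fun k => ((v0 + mu) k 0) ^+ 2))//=.
have -> : \sum_(k | k != j) ((wh + mu) k 0) ^+ 2 = Sb.
  by apply: eq_bigr => k _; rewrite mxE.
have -> : \sum_(k | k != j) ((v0 + mu) k 0) ^+ 2 = Sa.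
  by apply: eq_bigr => k kj; rewrite !mxE (negbTE kj).
have -> : (wh + mu) j 0 = h + mu j 0 by rewrite mxE.
have -> : (v0 + mu) j 0 = mu j 0 by rewrite !mxE eqxx add0r.
have v0E : \sum_i psi ((A *m v0) i 0 - xi i 0) <= PZ + D.
  rewrite /PZ /D mulr_sumr -big_split/=; apply: ler_sum => i _.
  have -> : (A *m v0) i 0 - xi i 0 = z i + r i.
    rewrite mxE (bigD1 j)//= !mxE eqxx mulr0 add0r /z /loo_residual subrK.
    by congr (_ - _); apply: eq_bigr => k kj; rewrite mxE (negbTE kj).
  have := psi_lip (z i + r i) (z i).
  have -> : z i + r i - z i = r i by ring.
  by rewrite ler_norml => /andP[_]; lra.
rewrite -/PY => opt0.
move: gapt; rewrite /relaxed_loss -/PZ -/Sa => gapt.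
have l2 : 0 < lambda / 2 by rewrite divr_gt0.
have wt2 : lambda / 2 * \sum_(k | k != j) (wt k + mu k 0) ^+ 2
    <= lambda / 2 * (Sa + t * (Sb - Sa)) by rewrite ler_pM2l.
have opt1 : PY - PZ + lambda / 2 * (Sb - Sa) <=
    D - lambda / 2 * h ^+ 2 - lambda * h * mu j 0.
  have : PY + lambda / 2 * ((h + mu j 0) ^+ 2 + Sb) <=
     PZ + D + lambda / 2 * (mu j 0 ^+ 2 + Sa) by lra.
  have -> : (h + mu j 0) ^+ 2 = h ^+ 2 + 2 * h * mu j 0 + mu j 0 ^+ 2 by ring.
  lra.
have := ler_wpM2l t0 opt1.
have -> : t * (PY - PZ + lambda / 2 * (Sb - Sa)) =
  t * (PY - PZ) + lambda / 2 * (t * (Sb - Sa)) by ring.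
rewrite mulrDr in wt2.
rewrite -/X; lra.
Qed.

End relaxed_leave_one_out.

(** * Measurable selection of near-minimisers *)

Lemma rat_sequence {R : realType} (x : R) :
  exists q : nat -> rat, ratr (q s) @[s --> \oo] --> x.
Proof.
have h s : exists q : rat, ratr q \in `]x, (x + s.+1%:R^-1)[.
  by apply: rat_in_itvoo; rewrite ltrDl invr_gt0.
have /choice[q qx] := h.
exists q; apply/cvgrPdist_le => e e0.
have := @cvg_harmonic R => /cvgrPdist_le /(_ e e0); apply: filterS => s.
rewrite /harmonic sub0r normrN; apply: le_trans.
have := qx s; rewrite in_itv/= => /andP[q1 q2].
rewrite distrC ger0_norm ?subr_ge0 ?(ltW q1)//.
by rewrite (le_trans _ (ler_norm _))// lerBlDl ltW.
Qed.

Lemma cvg_sum_fin {R : realType} (I : finType) (Q : pred I) (F : nat -> I -> R)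
    (f : I -> R) :
  (forall i, F s i @[s --> \oo] --> f i) ->
  (\sum_(i | Q i) F s i) @[s --> \oo] --> \sum_(i | Q i) f i.
Proof.
by move=> Ff; apply: cvg_big => [|i _]; [exact: add_continuous|exact: Ff].
Qed.

Section selection.
Context {R : realType} {m n : nat}.
Variables (psi : R -> R) (L lambda eps : R) (mu : 'cV[R]_n) (j : 'I_n).
Hypothesis psi_lip : forall x y, `|psi x - psi y| <= L * `|x - y|.
Hypothesis L0 : 0 < L.
Hypothesis lambda0 : 0 < lambda.
Hypothesis eps0 : 0 < eps.
Implicit Types (A : 'M[R]_(m, n)) (xi : 'cV[R]_m) (w : 'I_n -> R) (r : 'I_m -> R).

Lemma lipschitz_continuous_real : continuous psi.
Proof.
move=> x; apply/cvgrPdist_le => e e0; near=> y.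
apply: (le_trans (psi_lip x y)).
rewrite -ler_pdivlMl//; near: y.
apply: cvgr_dist_le; first exact: cvg_id.
by rewrite mulr_gt0// invr_gt0.
Unshelve. all: by end_near. Qed.

Lemma relaxed_loss_cvg A xi w r (ws : nat -> 'I_n -> R) (rs : nat -> 'I_m -> R) :
  (forall k, ws s k @[s --> \oo] --> w k) ->
  (forall i, rs s i @[s --> \oo] --> r i) ->
  relaxed_loss psi lambda eps mu j A xi (ws s) (rs s) @[s --> \oo] -->
  relaxed_loss psi lambda eps mu j A xi w r.
Proof.
move=> wsw rsr; rewrite /relaxed_loss /loo_residual.
apply: cvgD; last apply: cvgD.
- apply: cvg_sum_fin => i; apply: continuous_cvg; first exact: lipschitz_continuous_real.
  apply: cvgB; last exact: rsr.
  apply: cvgB; last exact: cvg_cst.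
  by apply: cvg_sum_fin => k; apply: cvgMl_tmp; exact: wsw.
- apply: cvgMl_tmp; apply: cvg_sum_fin => i; apply: cvgM; exact: rsr.
- apply: cvgMl_tmp; apply: cvg_sum_fin => k.
  by apply: cvgM; (apply: cvgD; [exact: wsw|exact: cvg_cst]).
Qed.

(** An enumeration with repetitions: integers that decode to nothing give the zero pair, which is
    harmless since only surjectivity matters. *)
Definition rational_point (k : nat) : {ffun 'I_n -> rat} * {ffun 'I_m -> rat} :=
  odflt ([ffun=> 0], [ffun=> 0]) (unpickle k).

Definition rational_w k (l : 'I_n) : R := ratr ((rational_point k).1 l).
Definition rational_r k (i : 'I_m) : R := ratr ((rational_point k).2 i).

Definition rational_loss A xi k :=
  relaxed_loss psi lambda eps mu j A xi (rational_w k) (rational_r k).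

Lemma rational_loss_dense A xi w r (e : R) : 0 < e ->
  exists k, rational_loss A xi k <= relaxed_loss psi lambda eps mu j A xi w r + e.
Proof.
move=> e0.
have /choice[qw qwE] := fun l => rat_sequence (w l).
have /choice[qr qrE] := fun i => rat_sequence (r i).
have := @relaxed_loss_cvg A xi _ _ _ _ qwE qrE.
move=> /cvgrPdist_le /(_ e e0) [s _ /(_ s (leqnn s))].
rewrite distrC ler_norml => /andP[_ h].
exists (pickle ([ffun l => qw l s], [ffun i => qr i s])).
rewrite /rational_loss.
have -> : rational_w (pickle ([ffun l => qw l s], [ffun i => qr i s])) =
    fun l => ratr (qw l s).
  by apply/funext => l; rewrite /rational_w /rational_point pickleK ffunE.
have -> : rational_r (pickle ([ffun l => qw l s], [ffun i => qr i s])) =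
    fun i => ratr (qr i s).
  by apply/funext => i; rewrite /rational_r /rational_point pickleK ffunE.
lra.
Qed.

(** A Lipschitz [psi] decreases at most linearly, with total coefficient [L] on [|r i|] and [al k]
    on [|w k|]; completing the squares in the two penalties absorbs both. *)
Lemma relaxed_loss_lower_bound A xi :
  exists B, forall w r, B <= relaxed_loss psi lambda eps mu j A xi w r.
Proof.
pose al k := L * \sum_i `|A i k|.
exists (\sum_i (psi 0 - L * `|xi i 0|)
  + (- \sum_(i < m) (eps * L ^+ 2 / 2)
     - \sum_(k | k != j) (al k * `|mu k 0| + al k ^+ 2 / (2 * lambda)))) => w r.
have psi_lb i : psi 0 - L * `|xi i 0|
    - L * `|r i| - \sum_(k | k != j) L * (`|A i k| * `|w k|)
    <= psi (loo_residual j A xi w r i).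
  have := psi_lip (loo_residual j A xi w r i) 0.
  rewrite subr0 ler_norml => /andP[+ _].
  have : L * `|loo_residual j A xi w r i| <=
      L * (\sum_(k | k != j) (`|A i k| * `|w k|) + `|xi i 0| + `|r i|).
    rewrite ler_pM2l// /loo_residual.
    rewrite (le_trans (ler_normB _ _))// lerD2r (le_trans (ler_normB _ _))// lerD2r.
    by rewrite (le_trans (ler_norm_sum _ _ _))//; under eq_bigr do rewrite normrM.
  rewrite -mulr_sumr !mulrDr; lra.
have r_lb i : - (eps * L ^+ 2 / 2) <= (2 * eps)^-1 * r i ^+ 2 - L * `|r i|.
  rewrite -(real_normK (num_real (r i))) -subr_ge0.
  have -> : (2 * eps)^-1 * `|r i| ^+ 2 - L * `|r i| - - (eps * L ^+ 2 / 2) =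
    (2 * eps)^-1 * (`|r i| - eps * L) ^+ 2 by field; rewrite gt_eqF.
  by rewrite mulr_ge0 ?sqr_ge0// invr_ge0 mulr_ge0// ltW.
have w_lb k : - (al k * `|mu k 0| + al k ^+ 2 / (2 * lambda)) <=
    lambda / 2 * (w k + mu k 0) ^+ 2 - al k * `|w k|.
  have al0 : 0 <= al k by rewrite mulr_ge0 ?(ltW L0)// sumr_ge0.
  have : al k * `|w k| <= al k * (`|w k + mu k 0| + `|mu k 0|).
    rewrite ler_wpM2l// -[X in `|X| <= _](addrK (mu k 0)).
    exact: ler_normB.
  rewrite -(real_normK (num_real (w k + mu k 0))).
  set u := `|w k + mu k 0|; set v := `|mu k 0|.
  have : 0 <= lambda / 2 * (u - al k / lambda) ^+ 2.
    by rewrite mulr_ge0 ?sqr_ge0// divr_ge0// ltW.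
  have -> : lambda / 2 * (u - al k / lambda) ^+ 2 =
    lambda / 2 * u ^+ 2 - al k * u + al k ^+ 2 / (2 * lambda).
    by field; rewrite gt_eqF.
  lra.
have s1 : \sum_i (psi 0 - L * `|xi i 0|) - \sum_i L * `|r i|
    - \sum_(k | k != j) al k * `|w k| <= \sum_i psi (loo_residual j A xi w r i).
  have -> : \sum_(k | k != j) al k * `|w k| =
     \sum_i \sum_(k | k != j) L * (`|A i k| * `|w k|).
    rewrite exchange_big/=; apply: eq_bigr => k _.
    by rewrite /al -mulrA mulr_suml mulr_sumr.
  by rewrite -!sumrB; apply: ler_sum => i _; exact: psi_lb.
have s2 : - \sum_(i < m) (eps * L ^+ 2 / 2) <=
    (2 * eps)^-1 * \sum_i r i ^+ 2 - \sum_i L * `|r i|.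
  rewrite -sumrN mulr_sumr -sumrB; apply: ler_sum => i _; exact: r_lb.
have s3 : - \sum_(k | k != j) (al k * `|mu k 0| + al k ^+ 2 / (2 * lambda)) <=
    lambda / 2 * \sum_(k | k != j) (w k + mu k 0) ^+ 2
    - \sum_(k | k != j) al k * `|w k|.
  rewrite -sumrN mulr_sumr -sumrB; apply: ler_sum => k _; exact: w_lb.
rewrite /relaxed_loss; lra.
Qed.

Variable eta : R.
Hypothesis eta0 : 0 < eta.

(** Comparison with countably many points only, so that the condition is measurable. The other half
    of [eta] pays for passing from rational to real competitors. *)
Definition near_optimal A xi k :=
  forall l, rational_loss A xi k <= rational_loss A xi l + eta / 2.

Lemma near_optimal_exists A xi : exists k, near_optimal A xi k.
Proof.
have [B hB] := relaxed_loss_lower_bound A xi.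
have hi : has_inf (range (rational_loss A xi)).
  by split; [exists (rational_loss A xi 0), 0%N|exists B => _ [k _ <-]; exact: hB].
have eta2 : 0 < eta / 2 by rewrite divr_gt0.
have [_ [k _ <-] hk] := inf_adherent eta2 hi.
exists k => l; rewrite (le_trans (ltW hk))// lerD2r.
by apply: ge_inf; [exact: hi.2|exists l].
Qed.

Lemma near_optimal_gap A xi k : near_optimal A xi k ->
  relaxed_gap psi lambda eps mu j A xi (rational_w k) (rational_r k) eta.
Proof.
move=> opt w r; have e2 : 0 < eta / 2 by rewrite divr_gt0.
have [l hl] := rational_loss_dense A xi w r e2.
have := opt l; rewrite /rational_loss in hl *; lra.
Qed.

Definition first_near_optimal A xi : set nat :=
  [set k | near_optimal A xi k /\ forall l, (l < k)%N -> ~ near_optimal A xi l].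

(* The default [0] is never used, see [near_optimal_indexP]. *)
Definition near_optimal_index A xi : nat := xget 0%N (first_near_optimal A xi).

Lemma near_optimal_indexP A xi k :
  (near_optimal_index A xi = k) <-> first_near_optimal A xi k.
Proof.
have [k0 opt0] : exists k, first_near_optimal A xi k.
  have ex : exists k, `[< near_optimal A xi k >].
    by have [l ?] := near_optimal_exists A xi; exists l; exact/asboolP.
  case: (ex_minnP ex) => k1 /asboolP ok kmin; exists k1; split=> // l lk /asboolP ol.
  by move: lk; rewrite ltnNge kmin.
have uniq k1 k2 : first_near_optimal A xi k1 -> first_near_optimal A xi k2 -> k1 = k2.
  move=> [n1 m1] [n2 m2]; case: (ltngtP k1 k2) => // kk.
    by have := m2 _ kk n1.
  by have := m1 _ kk n2.
have idx : first_near_optimal A xi (near_optimal_index A xi).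
  by rewrite /near_optimal_index; case: xgetP => [x _ //|/(_ k0)].
by split=> [<-//|ok]; exact: uniq idx ok.
Qed.

Definition dual_selection A xi (i : 'I_m) : R :=
  rational_r (near_optimal_index A xi) i / eps.

Lemma dual_selection_gap A xi : exists w r,
  relaxed_gap psi lambda eps mu j A xi w r eta /\
  forall i, dual_selection A xi i = r i / eps.
Proof.
exists (rational_w (near_optimal_index A xi)), (rational_r (near_optimal_index A xi)).
split=> //; apply: near_optimal_gap.
by have /near_optimal_indexP[] := erefl (near_optimal_index A xi).
Qed.

Section measurability.
Context {d} {T : measurableType d}.
Variables (A : T -> 'M[R]_(m, n)) (xi : T -> 'cV[R]_m).
Hypothesis mA : forall i k, k != j -> measurable_fun setT (fun t => A t i k).
Hypothesis mxi : forall i, measurable_fun setT (fun t => xi t i 0).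

Lemma measurable_rational_loss k :
  measurable_fun setT (fun t => rational_loss (A t) (xi t) k).
Proof.
rewrite /rational_loss /relaxed_loss; apply: measurable_funD => //.
apply: measurable_sum => i; apply: measurableT_comp.
  by apply: continuous_measurable_fun; exact: lipschitz_continuous_real.
rewrite /loo_residual; apply: measurable_funB => //; apply: measurable_funB => //.
under eq_fun do rewrite big_mkcond/=.
apply: measurable_sum => l /=; case: (boolP (l != j)) => lj; last exact: measurable_cst.
by apply: measurable_funM => //; exact: mA.
Qed.

Lemma measurable_near_optimal k :
  measurable [set t | near_optimal (A t) (xi t) k].
Proof.
have -> : [set t | near_optimal (A t) (xi t) k] =
  \bigcap_l ((fun t => rational_loss (A t) (xi t) k <= rational_loss (A t) (xi t) l + eta / 2)
     @^-1` [set true]).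
  by apply/seteqP; split=> t /= h l; [move=> _; exact: h|exact: (h l I)].
apply: bigcapT_measurable => l; rewrite -[X in measurable X]setTI.
apply: measurable_fun_ler => //; first exact: measurable_rational_loss.
by apply: measurable_funD => //; exact: measurable_rational_loss.
Qed.

Lemma measurable_near_optimal_index k :
  measurable [set t | near_optimal_index (A t) (xi t) = k].
Proof.
have -> : [set t | near_optimal_index (A t) (xi t) = k] =
    [set t | near_optimal (A t) (xi t) k] `&`
    \bigcap_(l in `I_k) ~` [set t | near_optimal (A t) (xi t) l].
  by apply/seteqP; split=> t /=; rewrite near_optimal_indexP.
apply: measurableI; first exact: measurable_near_optimal.
apply: bigcap_measurableType => l _; apply: measurableC; exact: measurable_near_optimal.
Qed.

(** The selection takes countably many values, one for each index. The space [T] is arbitrary and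
    only the columns other than [j] are assumed measurable, so that [T] can carry the sigma-algebra
    that leaves out an entry of column [j]. *)
Lemma measurable_dual_selection i :
  measurable_fun setT (fun t => dual_selection (A t) (xi t) i).
Proof.
move=> _ B mB; rewrite setTI.
have -> : (fun t => dual_selection (A t) (xi t) i) @^-1` B =
    \bigcup_(k in [set k | B (rational_r k i / eps)])
      [set t | near_optimal_index (A t) (xi t) = k].
  apply/seteqP; split=> t /=; first by move=> Bt; exists (near_optimal_index (A t) (xi t)).
  by move=> [k Bk kt]; rewrite /dual_selection kt.
apply: bigcup_measurable => k _; exact: measurable_near_optimal_index.
Qed.

End measurability.

End selection.

(** * The moment bound *)

(* [f] need not be measurable: its integral is a supremum over the simple
   functions below it. *)
Lemma ge0_le_integral_nonmeasurable {d} {T : measurableType d} {R : realType}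
    (mu : {measure set T -> \bar R}) (f g : T -> \bar R) :
  (forall x, 0 <= f x)%E -> (forall x, f x <= g x)%E ->
  (\int[mu]_x f x <= \int[mu]_x g x)%E.
Proof.
move=> f0 fg; have g0 x : (0 <= g x)%E by exact: le_trans (f0 x) (fg x).
rewrite !ge0_integralTE//; apply: le_ereal_sup => _ [h hf <-].
by exists h => // x; exact: le_trans (hf x) (fg x).
Qed.

Lemma powR_add4_le {R : realType} (p a b c e : R) : 0 <= p ->
  0 <= a -> 0 <= b -> 0 <= c -> 0 <= e ->
  (a + b + c + e) `^ p <= 4 `^ p * (a `^ p + b `^ p + c `^ p + e `^ p).
Proof.
move=> p0 a0 b0 c0 e0.
pose M := Num.max (Num.max a b) (Num.max c e).
have Ma : a <= M by rewrite !le_max lexx.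
have Mb : b <= M by rewrite !le_max lexx orbT.
have Mc : c <= M by rewrite !le_max lexx !orbT.
have Me : e <= M by rewrite !le_max lexx !orbT.
have M0 : 0 <= M by exact: le_trans Ma.
apply: (@le_trans _ _ ((4 * M) `^ p)).
  by apply: powR_homo => //; rewrite ?addr_ge0//; lra.
rewrite powRM// ler_wpM2l ?powR_ge0//.
have := powR_ge0 a p; have := powR_ge0 b p; have := powR_ge0 c p; have := powR_ge0 e p.
rewrite /M /Num.max; case: ifP => _; case: ifP => _; (try case: ifP => _); lra.
Qed.

(** Each [x i] is at most the [l^p] norm [X], hence so is the mean; the normalisation contributes
    [m^(-p/2) <= 1 / m]. *)
Lemma powR_mean_le {R : realType} (p : R) (m : nat) (x : 'I_m -> R) : 2 <= p ->
  (0 < m)%N -> (forall i, 0 <= x i) ->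
  ((\sum_i x i / Num.sqrt m%:R) / m%:R) `^ p <= m%:R^-1 * \sum_i x i `^ p.
Proof.
move=> p2 m0 x0.
have p0 : 0 < p by lra.
have N0 : 0 < m%:R :> R by rewrite ltr0n.
have N1 : 1 <= m%:R :> R by rewrite ler1n.
set S := \sum_i x i `^ p.
have S0 : 0 <= S by apply: sumr_ge0 => i _; exact: powR_ge0.
pose X := S `^ p^-1.
have xX i : x i <= X.
  have -> : x i = (x i `^ p) `^ p^-1 by rewrite -powRrM divff ?powRr1// gt_eqF.
  apply: powR_homo; [by rewrite invr_ge0 ltW|exact: powR_ge0|].
  by rewrite /S (bigD1 i)//= lerDl; apply: sumr_ge0 => k _; exact: powR_ge0.
have s0 : 0 < Num.sqrt m%:R :> R by rewrite sqrtr_gt0.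
apply: (@le_trans _ _ ((X / Num.sqrt m%:R) `^ p)).
  apply: powR_homo; first exact: ltW.
    by apply: divr_ge0 => //; apply: sumr_ge0 => i _; rewrite divr_ge0// ltW.
  rewrite ler_pdivrMr// -mulr_suml mulrAC ler_wpM2r ?invr_ge0 ?(ltW s0)//.
  by rewrite mulr_natr -[X in _ *+ X]card_ord -sumr_const; exact: ler_sum.
rewrite powRM ?powR_ge0 ?invr_ge0 ?(ltW s0)//.
rewrite -powRrM mulVf ?gt_eqF// powRr1// mulrC ler_wpM2r//.
have -> : (Num.sqrt m%:R)^-1 `^ p = (m%:R `^ (p / 2))^-1 :> R.
  rewrite -[X in X `^ p]powR_inv1 ?(ltW s0)// -powR12_sqrt ?(ltW N0)// -!powRrM.
  by rewrite -powRN; congr (_ `^ _); ring.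
rewrite lef_pV2 ?posrE ?powR_gt0// le1r_powR//.
by rewrite ler_pdivlMr// mul1r.
Qed.

(** [16^p] combines the factor 4 of the pointwise bound with the [4^p] of [powR_add4_le]; [3^p]
    comes from [|c_i| <= 3 L]; the 1 covers the mean of the [|a_i|] and the [mu] term. *)
Definition coordinate_moment_cst {R : realType} (p : R) : R :=
  16 `^ p * (3 `^ p * moment_cst p + 1).

Section assembly.
Context {R : realType} {m n : nat} {d} {T : measurableType d}.
Variables (P : probability T R) (p lambda L : R) (psi : R -> R) (mu : 'cV[R]_n).
Variables (A : T -> 'M[R]_(m, n)) (xi : T -> 'cV[R]_m) (b : R) (j : 'I_n).
Hypothesis p2 : 2 <= p.
Hypothesis m0 : (0 < m)%N.
Hypothesis lambda0 : 0 < lambda.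
Hypothesis cpsi : condM2 psi L.
Hypothesis cA : condM3 P A xi.
Hypothesis EAp : forall i, ('E_P[fun t => (`|scaled_entry A (i, j) t| `^ p)%R] <= b%:E)%E.

Let sq : R := Num.sqrt m%:R.

(** [c] is a deterministic function of the data, measurable over every space [T']: it can thus be
    read over each of the [m] leave-one-out sigma-algebras in turn. The weights [c_i / sqrt m] in
    front of the scaled entries cancel the factor [m^(p/2)] of [column_moment]. *)
Lemma dual_moment_le (c : forall (A : 'M[R]_(m, n)) (xi : 'cV[R]_m), 'I_m -> R) (B : R) :
  (forall A xi i, `|c A xi i| <= B) ->
  (forall d' (T' : measurableType d') (A : T' -> 'M[R]_(m, n)) (xi : T' -> 'cV[R]_m),
    (forall i k, k != j -> measurable_fun setT (fun t => A t i k)) ->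
    (forall i, measurable_fun setT (fun t => xi t i 0)) ->
    forall i, measurable_fun setT (fun t => c (A t) (xi t) i)) ->
  ('E_P[fun t => (`|\sum_i c (A t) (xi t) i * A t i j| `^ p)%R] <=
    (moment_cst p * B `^ p * b)%:E)%E.
Proof.
move=> cB mc.
have N0 : 0 < m%:R :> R by rewrite ltr0n.
have s0 : 0 < sq by rewrite sqrtr_gt0.
have B0 : 0 <= B by exact: le_trans (cB (A point) (xi point) (Ordinal m0)).
have [[mX mY] XY indX [EV _] _] := cA.
have AE t i k : A t i k = scaled_entry A (i, k) t / sq.
  by rewrite /scaled_entry/= mulrAC divff ?gt_eqF// mul1r.
pose G i := leave_one_out (scaled_entry A) (fun i t => xi t i 0) (i, j).
pose V i := scaled_entry A (i, j).
pose a i t := c (A t) (xi t) i / sq.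
have := @column_moment _ _ _ P m G V a p b (B / sq).
have -> : (fun t => `|\sum_i a i t * V i t| `^ p) =
    fun t => `|\sum_i c (A t) (xi t) i * A t i j| `^ p.
  apply/funext => t; congr (`|_| `^ _); apply: eq_bigr => i _.
  by rewrite AE /a /V; ring.
have -> : moment_cst p * m%:R `^ (p / 2) * (B / sq) `^ p * b = moment_cst p * B `^ p * b.
  rewrite powRM ?invr_ge0 ?(ltW s0)// -[sq^-1]powR_inv1 ?(ltW s0)//.
  rewrite /sq -powR12_sqrt ?(ltW N0)// -!powRrM.
  have -> : 2^-1 * (-1 * p) = - (p / 2) by ring.
  rewrite powRN; field.
  by rewrite gt_eqF// powR_gt0.
apply => //.
- by move=> i; exact: leave_one_out_measurable.
- by move=> i E C sE mC; exact: (leave_one_out_indep mX mY XY indX).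
- by move=> i; exact: mX.
- by move=> i k ki; apply: measurable_leave_one_out_X; rewrite xpair_eqE eqxx andbT.
- move=> i k; rewrite /a; apply: measurable_funM => //.
  apply: (mc _ (g_sigma_algebraType (G i)) A xi) => [i' k' k'j|i'].
    under eq_fun do rewrite AE; apply: measurable_funM => //.
    by apply: measurable_leave_one_out_X; rewrite xpair_eqE (negbTE k'j) andbF.
  have := @measurable_leave_one_out_Y _ _ _ _ _ (scaled_entry A) (fun i t => xi t i 0) (i, j) i'.
  by move=> h; exact: h.
- by move=> k t; rewrite /a normrM normfV (gtr0_norm s0) ler_pM2r// invr_gt0.
- by move=> i; have [] := EV (i, j).
Qed.

Lemma integral_affine_moments (k0 k1 k2 : R) (f : T -> R) (g : 'I_m -> T -> R)
    (bf bg : R) : 0 <= k0 -> 0 <= k1 -> 0 <= k2 ->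
  measurable_fun setT f -> (forall i, measurable_fun setT (g i)) ->
  ('E_P[fun t => (`|f t| `^ p)%R] <= bf%:E)%E ->
  (forall i, 'E_P[fun t => (`|g i t| `^ p)%R] <= bg%:E)%E ->
  (\int[P]_t (k0 + k1 * `|f t| `^ p + k2 * \sum_i `|g i t| `^ p)%:E <=
   (k0 + k1 * bf + k2 * (m%:R * bg))%:E)%E.
Proof.
move=> k00 k10 k20 mf mg Ef Eg.
have mfp : measurable_fun setT (fun t => (`|f t| `^ p)%:E).
  exact/measurable_EFinP/measurable_powR_norm.
have mgp i : measurable_fun setT (fun t => (`|g i t| `^ p)%:E).
  exact/measurable_EFinP/measurable_powR_norm.
have mk1 : measurable_fun setT (fun t => k1%:E * (`|f t| `^ p)%:E)%E.
  exact: measurable_funeM.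
have msum : measurable_fun setT (fun t => \sum_i (`|g i t| `^ p)%:E)%E.
  exact: emeasurable_sum.
have mk2 : measurable_fun setT (fun t => k2%:E * \sum_i (`|g i t| `^ p)%:E)%E.
  exact: measurable_funeM.
under eq_integral => t _ do rewrite !EFinD !EFinM -sumEFin.
have nn1 t : (0 <= k1%:E * (`|f t| `^ p)%:E)%E.
  by rewrite -EFinM lee_fin mulr_ge0 ?powR_ge0.
have nns t : (0 <= \sum_i (`|g i t| `^ p)%:E)%E.
  by apply: sume_ge0 => i _; rewrite lee_fin powR_ge0.
have mk01 : measurable_fun setT (fun t => k0%:E + k1%:E * (`|f t| `^ p)%:E)%E.
  exact: emeasurable_funD.
have nn01 t : (0 <= k0%:E + k1%:E * (`|f t| `^ p)%:E)%E by rewrite adde_ge0.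
have nn2 t : (0 <= k2%:E * \sum_i (`|g i t| `^ p)%:E)%E by rewrite mule_ge0.
rewrite ge0_integralD//.
rewrite ge0_integralD// integral_cst//= probability_setT mule1.
rewrite ge0_integralZl// ge0_integralZl// ge0_integral_sum//.
have Ef' : (\int[P]_t (`|f t| `^ p)%:E <= bf%:E)%E by move: Ef; rewrite unlock.
rewrite !EFinD !EFinM !leeD// lee_wpmul2l//.
apply: (@le_trans _ _ (\sum_(i < m) bg%:E)%E).
  by apply: lee_sum => i _; have := Eg i; rewrite unlock.
by rewrite sumEFin sumr_const card_ord -EFinM mulr_natl.
Qed.

Lemma coordinate_moment_le (e : R) : 0 < e ->
  ('E_P[fun t => (`|robust_error psi lambda mu (A t) (xi t) j ord0| `^ p)%R] <=
   (coordinate_moment_cst p * ((L / lambda) `^ p * b + `|mu| `^ p) + e)%:E)%E.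
Proof.
move=> e0.
have [cvx L0 _] := cpsi.
have lip := condM2_lipschitz cpsi.
have p0 : 0 < p by rewrite (lt_le_trans _ p2).
have p0' := ltW p0.
have N0 : 0 < m%:R :> R by rewrite ltr0n.
have s0 : 0 < sq by rewrite sqrtr_gt0.
have [[mX mY] _ _ _ _] := cA.
have AE t i k : A t i k = scaled_entry A (i, k) t / sq.
  by rewrite /scaled_entry/= mulrAC divff ?gt_eqF// mul1r.
have pconv t x y : 0 <= t -> t <= 1 -> psi (x + t * (y - x)) <= psi x + t * (psi y - psi x).
  move=> t0 t1; have t01 : 0 <= 1 - t <= 1 by lra.
  have := cvx (Itv01 (andP t01).1 (andP t01).2) x y.
  rewrite !inE => /(_ I I).
  change (psi ((1 - t) * x + (1 - (1 - t)) * y) <= (1 - t) * psi x + (1 - (1 - t)) * psi y ->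
    psi (x + t * (y - x)) <= psi x + t * (psi y - psi x)).
  have -> : (1 - t) * x + (1 - (1 - t)) * y = x + t * (y - x) by ring.
  by have -> : (1 - t) * psi x + (1 - (1 - t)) * psi y = psi x + t * (psi y - psi x) by ring.
(* [theta] is tuned so that its final contribution [16^p * theta^p] is exactly [e]; then [eps] and
   [eta] are the largest values allowed by [relaxed_gap_coordinate]. *)
pose theta := (e / 16 `^ p) `^ p^-1.
have C0 : 0 < 16 `^ p :> R by rewrite powR_gt0.
have th0 : 0 < theta by rewrite powR_gt0// divr_gt0.
have thp : 16 `^ p * theta `^ p = e.
  rewrite /theta -powRrM mulVf ?gt_eqF// powRr1 ?divr_ge0 ?(ltW e0) ?(ltW C0)//.
  by rewrite mulrC divfK ?gt_eqF.
pose eps := lambda * theta ^+ 2 / (28 * m%:R * L ^+ 2).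
have L2 : 0 < L ^+ 2 by rewrite exprn_gt0.
have eps0 : 0 < eps by rewrite divr_gt0 ?mulr_gt0 ?exprn_gt0.
have epsE : 28 * m%:R * eps * L ^+ 2 <= lambda * theta ^+ 2.
  rewrite le_eqVlt; apply/orP; left; apply/eqP; rewrite /eps; field.
  by rewrite !gt_eqF.
pose eta := eps * L ^+ 2 / m%:R ^+ 2.
have Nn : 0 < m%:R ^+ 2 :> R by rewrite exprn_gt0.
have eta0 : 0 < eta by apply: divr_gt0 => //; exact: mulr_gt0.
have etaL : eta <= eps * L ^+ 2.
  rewrite /eta ler_pdivrMr ?exprn_gt0// ler_peMr ?(ltW (mulr_gt0 eps0 L2))//.
  by rewrite exprn_ege1// ler1n.
pose c := @dual_selection R m n psi lambda eps mu j eta.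
have cB M x i : `|c M x i| <= 3 * L.
  have [w [r [gap cr]]] := dual_selection_gap mu j lip L0 lambda0 eps0 eta0 M x.
  rewrite /c cr.
  have := relaxed_gap_dual_bound lip L0 eps0 etaL gap i.
  rewrite normrM normfV (gtr0_norm eps0) ler_pdivrMr//.
  by rewrite [3 * L * eps]mulrAC.
have mc d' (T' : measurableType d') (M : T' -> 'M[R]_(m, n)) (x : T' -> 'cV[R]_m) :
    (forall i k, k != j -> measurable_fun setT (fun t => M t i k)) ->
    (forall i, measurable_fun setT (fun t => x t i 0)) ->
    forall i, measurable_fun setT (fun t => c (M t) (x t) i).
  by move=> mM mx i; exact: measurable_dual_selection.
have EZ := dual_moment_le cB mc.
pose Z t := \sum_i c (A t) (xi t) i * A t i j.
have mZ : measurable_fun setT Z.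
  apply: measurable_sum => i; apply: measurable_funM.
    apply: mc => [i' k _|i']; last exact: mY.
    by under eq_fun do rewrite AE; apply: measurable_funM.
  by under eq_fun do rewrite AE; apply: measurable_funM.
have muj : `|mu j 0| <= `|mu|.
  rewrite [leRHS]mx_normrE.
  exact: (le_bigmax 0 (fun kl => `|mu kl.1 kl.2|) (j, ord0)).
pose k0 := 16 `^ p * (`|mu| `^ p + theta `^ p).
pose k1 := 16 `^ p * lambda^-1 `^ p.
pose k2 := 16 `^ p * (L / lambda) `^ p / m%:R.
have k00 : 0 <= k0 by rewrite mulr_ge0 ?powR_ge0// addr_ge0 ?powR_ge0.
have k10 : 0 <= k1 by rewrite mulr_ge0 ?powR_ge0.
have k20 : 0 <= k2 by rewrite divr_ge0 ?mulr_ge0 ?powR_ge0.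
rewrite unlock; apply: (@le_trans _ _ (\int[P]_t (k0 + k1 * `|Z t| `^ p
    + k2 * \sum_i `|scaled_entry A (i, j) t| `^ p)%:E)%E).
  (* Only the dominating function is shown to be measurable; the robust error is compared with it
     pointwise. *)
  apply: ge0_le_integral_nonmeasurable => t; first by rewrite lee_fin powR_ge0.
  rewrite lee_fin /robust_error; case: xgetP => [w _ wopt|_]; last first.
    (* Without a minimiser [xget] returns 0, and the bound is trivial. *)
    rewrite mxE normr0 powR0 ?gt_eqF// !addr_ge0// mulr_ge0 ?powR_ge0//.
    by apply: sumr_ge0 => i _; exact: powR_ge0.
  have [w' [r [gap cr]]] := dual_selection_gap mu j lip L0 lambda0 eps0 eta0 (A t) (xi t).
  have := relaxed_gap_coordinate lip pconv L0 lambda0 eps0 m0 (ltW th0) epsE (lexx _) gap wopt.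
  have -> : \sum_i r i / eps * A t i j = Z t.
    by apply: eq_bigr => i _; rewrite -cr.
  set W := (\sum_i `|A t i j|) / m%:R => hw.
  have W0 : 0 <= W by rewrite divr_ge0// sumr_ge0.
  have Wp : W `^ p <= m%:R^-1 * \sum_i `|scaled_entry A (i, j) t| `^ p.
    have -> : W = (\sum_i `|scaled_entry A (i, j) t| / sq) / m%:R.
      congr (_ / _); apply: eq_bigr => i _.
      by rewrite AE normrM normfV (gtr0_norm s0).
    exact: powR_mean_le.
  have l0 : 0 <= lambda^-1 by rewrite invr_ge0 ltW.
  have hw' : `|w j ord0| <= 4 * (`|mu| + `|Z t| / lambda + L / lambda * W + theta).
    apply: le_trans hw _.
    have -> : 4 * L / lambda * W = 4 * (L / lambda * W) by ring.
    have := ltW th0; move: muj; lra.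
  apply: (@le_trans _ _ ((4 * (`|mu| + `|Z t| / lambda + L / lambda * W + theta)) `^ p)).
    exact: powR_homo.
  have Zl0 : 0 <= `|Z t| / lambda by rewrite mulr_ge0.
  have Ll0 : 0 <= L / lambda by rewrite divr_ge0 ?(ltW L0) ?(ltW lambda0).
  have LW0 : 0 <= L / lambda * W by rewrite mulr_ge0.
  rewrite powRM//; last by rewrite !addr_ge0// ltW.
  apply: (le_trans (ler_wpM2l (powR_ge0 _ _)
    (powR_add4_le p0' (normr_ge0 _) Zl0 LW0 (ltW th0)))).
  rewrite mulrA -powRM// (_ : 4 * 4 = 16); last by ring.
  rewrite (powRM _ (normr_ge0 (Z t)) l0) (powRM _ Ll0 W0).
  rewrite /k0 /k1 /k2 -subr_ge0.
  have h : 0 <= 16 `^ p * (L / lambda) `^ p *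
    (m%:R^-1 * \sum_i `|scaled_entry A (i, j) t| `^ p - W `^ p).
    by rewrite mulr_ge0 ?subr_ge0// mulr_ge0 ?powR_ge0.
  apply: le_trans h _; rewrite le_eqVlt; apply/orP; left; apply/eqP; ring.
apply: le_trans (integral_affine_moments k00 k10 k20 mZ (fun i => mX (i, j)) EZ EAp) _.
rewrite lee_fin /coordinate_moment_cst -{1}thp /k0 /k1 /k2.
have -> : (3 * L) `^ p = 3 `^ p * L `^ p by rewrite powRM// ltW.
have -> : (L / lambda) `^ p = L `^ p * lambda^-1 `^ p.
  by rewrite powRM ?(ltW L0)// invr_ge0 ltW.
have mc0 : 0 <= moment_cst p :> R.
  by rewrite mulr_ge0 ?growth_cst_ge0 ?expR_ge0.
have hm : 0 <= 16 `^ p * (3 `^ p * moment_cst p) * `|mu| `^ p.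
  by rewrite mulr_ge0 ?powR_ge0// mulr_ge0 ?powR_ge0// mulr_ge0 ?powR_ge0.
rewrite -subr_ge0; apply: le_trans hm _.
rewrite le_eqVlt; apply/orP; left; apply/eqP; field.
by rewrite gt_eqF.
Qed.

End assembly.

Theorem proposition3p11 (R : realType) (p : R) (hp : 2 <= p) :
  exists K : R, 0 < K /\
  forall (m n : nat) (lambda L0 : R) (psi0 : R -> R) (mu0 : 'cV[R]_n)
    (d : measure_display) (T : measurableType d) (P : probability T R)
    (A : T -> 'M[R]_(m, n)) (xi : T -> 'cV[R]_m),
  condM1 m n lambda -> condM2 psi0 L0 -> condM3 P A xi ->
  (\big[maxe/-oo]_(j < n)
     'E_P[fun t => (`|robust_error psi0 lambda mu0 (A t) (xi t) j ord0| `^ p)%R]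
   <= K%:E * (((L0 / lambda) `^ p)%:E * entry_moment P p A
              + (`|mu0| `^ p)%:E))%E.
Proof.
exists (coordinate_moment_cst p).
have K0 : 0 < coordinate_moment_cst p.
  rewrite mulr_gt0 ?powR_gt0// ltr_wpDl// mulr_ge0 ?powR_ge0//.
  by rewrite mulr_ge0 ?growth_cst_ge0 ?expR_ge0.
split=> // m n lambda L psi mu d T P A xi [[tau [/andP[tau0 _] /andP[taum _]]] lambda0] cpsi cA.
have m0 : (0 < m)%N.
  by rewrite lt0n; apply: contraTneq taum => ->; rewrite mul0r -ltNge.
have [_ L0 _] := cpsi.
have c0 : 0 < (L / lambda) `^ p by rewrite powR_gt0// divr_gt0.
apply: bigmax_le => [|j _]; first by rewrite leNye.
have EM i : ('E_P[fun t => (`|scaled_entry A (i, j) t| `^ p)%R] <= entry_moment P p A)%E.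
  apply: le_trans (le_bigmax _ _ i).
  exact: (le_bigmax _ (fun j => 'E_P[fun t => (`|scaled_entry A (i, j) t| `^ p)%R])%E).
(* In the finite case the bound holds up to every [e > 0]. For large [p] the moment may be [+oo],
   and the right-hand side is then infinite because [(L / lambda)^p > 0]. The value [-oo] is that of
   an empty maximum, excluded by the index [(Ordinal m0, j)]. *)
case ME: (entry_moment P p A) => [b| |].
- apply/lee_addgt0Pr => e e0.
  have EMb i : ('E_P[fun t => (`|scaled_entry A (i, j) t| `^ p)%R] <= b%:E)%E.
    by rewrite -ME.
  have := coordinate_moment_le mu hp m0 lambda0 cpsi cA EMb e0.
  by rewrite EFinD EFinM EFinD EFinM.
- by rewrite gt0_muley ?lte_fin// addye// gt0_muley ?lte_fin// leey.
- have := EM (Ordinal m0); rewrite ME leeNy_eq => /eqP E; exfalso.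
  have : (0 <= 'E_P[fun t => (`|scaled_entry A (Ordinal m0, j) t| `^ p)%R])%E.
    by rewrite unlock; apply: integral_ge0 => t _; rewrite lee_fin powR_ge0.
  by rewrite E.
Qed.
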